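(* Let $\mathcal M=\mathcal B(\mathcal H)$, and let $a,b\in\mathcal M$ be normal operators with spectral measures $E^a$ and $E^b$, respectively. The following conditions are equivalent: (i) $b\in\overline{\mathcal O_a}$ (closure in the operator norm). (ii) $\operatorname{spec}(a)\cup\{0\}=\operatorname{spec}(b)\cup\{0\}$ and $E^a(\Delta)\sim E^b(\Delta)$ in $\mathcal M$ for every open subset $\Delta\subseteq\mathbb C\setminus\{0\}$.
   Context: $\mathcal H$ is a separable infinite-dimensional complex Hilbert space. For normal $a\in\mathcal B(\mathcal H)$, $p_a$ denotes the orthogonal projection onto $\overline{\operatorname{Ran}a}$, and the groupoid orbit of $a$ is $\mathcal O_a:=\{vav^*\mid v\in\mathcal B(\mathcal H),\ v^*v=p_a\}$. For projections $p,q\in\mathcal M$, $p\sim q$ denotes Murray–von Neumann equivalence: there is $v\in\mathcal M$ with $v^*v=p$, $vv^*=q$. *)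

(* Defs.v *)
From HB Require Import structures.
From mathcomp Require Import all_boot all_order all_algebra.
From mathcomp Require Import all_classical all_reals all_analysis.
From mathcomp Require Import complex.
Import Order.TTheory GRing.Theory Num.Theory.
Import numFieldNormedType.Exports.

Set Implicit Arguments.
Unset Strict Implicit.
Unset Printing Implicit Defensive.

Local Open Scope classical_set_scope.
Local Open Scope ring_scope.
Local Open Scope complex_scope.

(* The complex plane R[i], with the metric topology of the modulus (carried by
   the regular module R[i]^o) and the associated Borel sigma-algebra. *)
Definition plane (R : realType) : ptopologicalType := R[i]^o.
Definition borelC (R : realType) := g_sigma_algebraType (@open (plane R)).

(* The negation of finite-dimensionality: no finite family spans. *)
Definition infinite_dim (K : numFieldType) (H : normedModType K) : Prop :=
  ~ exists n (e : 'I_n -> H), forall x, exists c : 'I_n -> K,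
      x = \sum_(i < n) c i *: e i.

Definition separable (T : topologicalType) : Prop :=
  exists D : set T, countable D /\ dense D.

Section operators.
Context (R : realType) (H : completeNormedModType R[i]).
Context (ip : {dot H for (@Num.conj R[i])}).

(* B(H).  Sums, products and equality of operators are taken on the underlying
   functions, with =1 for equality. *)
Record bop := BOp {
  bop_fun :> {linear H -> H};
  bop_continuous : continuous bop_fun }.

Definition opnorm (f : H -> H) : R :=
  sup [set complex.Re `|f x| | x in [set x : H | `|x| <= 1]].

Definition opclosure (S : set bop) : set bop :=
  [set b : bop | forall e : R, 0 < e ->
     exists2 c, S c & opnorm (fun x => b x - c x) < e].

(* w is the adjoint v^* of v.  Such a w exists by the Riesz theorem and is unique
   up to =1, so "exists w, is_adjoint v w /\ ..." speaks of v^*. *)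
Definition is_adjoint (v w : bop) : Prop :=
  forall x y, ip (v x) y = ip x (w y).

Definition normal_op (a : bop) : Prop :=
  exists2 w : bop, is_adjoint a w & w \o a =1 a \o w.

Definition orth_proj (p : bop) : Prop := p \o p =1 p /\ is_adjoint p p.

(* p is the projection p_a, unique up to =1. *)
Definition range_proj (a p : bop) : Prop :=
  orth_proj p /\ range p = closure (range a).

Definition groupoid_orbit (a : bop) : set bop :=
  [set c : bop | exists v w p : bop,
     [/\ range_proj a p, is_adjoint v w, w \o v =1 p & c =1 v \o a \o w]].

Definition mvn_equiv (p q : bop) : Prop :=
  exists v w : bop, [/\ is_adjoint v w, w \o v =1 p & v \o w =1 q].

Definition spectrum (a : bop) : set (plane R) :=
  [set l : R[i] | ~ exists c : bop,
     (forall x, c (a x - l *: x) = x) /\ (forall x, a (c x) - l *: c x = x)].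

(* E is the spectral measure of the normal operator a: the projection-valued
   measure on the Borel sets of C, carried by the spectrum of a, such that
   a = \int z dE(z).  The integral is meant weakly: with the positive measure
   mu(D) = <E(D) x, x>, one has <a x, x> = \int z dmu(z) for all x, which by
   polarization determines a.  As the spectrum is bounded, both real integrands
   are mu-integrable.  The values of E outside the Borel sets are irrelevant. *)
Record spectral_measure (a : bop) (E : set (borelC R) -> bop) : Prop := {
  spm_proj : forall D, measurable D -> orth_proj (E D);
  spm_setT : E setT =1 id;
  spm_setI : forall D1 D2, measurable D1 -> measurable D2 ->
    E (D1 `&` D2) =1 E D1 \o E D2;
  spm_sigma_additive : forall F : nat -> set (borelC R),
    (forall n, measurable (F n)) -> trivIset setT F ->
    forall x, \sum_(0 <= i < n) E (F i) x @[n --> \oo] --> E (\bigcup_n F n) x;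
  spm_spectrum : E (spectrum a) =1 id;
  spm_integral : forall x, exists2 mu : {measure set (borelC R) -> \bar R},
    (forall D, measurable D -> mu D = (complex.Re (ip (E D x) x))%:E) &
    ip (a x) x = (\int[mu]_z complex.Re z) +i* (\int[mu]_z complex.Im z) }.

End operators.

(* Main.v *)
Require Import Defs.
From HB Require Import structures.
From mathcomp Require Import all_boot all_order all_algebra.
From mathcomp Require Import all_classical all_reals all_analysis.
From mathcomp Require Import complex.
From mathcomp Require Import measurable_realfun lra ring.
Import Order.TTheory GRing.Theory Num.Theory.
Import numFieldNormedType.Exports.
Local Open Scope classical_set_scope.
Local Open Scope ring_scope.
Local Open Scope complex_scope.

Set Implicit Arguments.
Unset Strict Implicit.

(** Both directions rest on two facts about an operator [a] with spectral measure
    [E].  On the range of [E D], with [D] contained in a square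
    of centre [l] and half-side [r], the operator [a - l] has norm at most [2 r];
    with [D] disjoint from that square, it is bounded below by [r] and its image
    contains the range.  Both follow from the scalar inequalities
    [s |x|^2 <= Re <a x, x> <= t |x|^2], valid when [Re z] ranges over [[s, t]]
    on [D] (and likewise for [Im]), once [a] is known to commute with [E D]
    ([spm_commute], [spm_upper], [invertible_away]).  They imply that [l] is in
    the spectrum iff [E] charges every square around [l] ([spectrumP]), and that
    the range projection of [a] is [E] of the complement of [0]
    ([spm_range_proj]).

    In a separable space two projections are equivalent iff they have the same
    rank in the extended sense: matching orthonormal bases of the two ranges
    define the partial isometry ([mvn_of_rank]).

    From the closure to ranks.  Let [b] be close to [v a v^*] and let [Q] be a
    square that avoids [0], and [Q'] a much smaller square with the same centre.
    If [x] is in the range of [Ea Q'] then [b - l] is small on [v x], so [v x]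
    cannot lie in the range of [Eb] of the complement of [Q]: the map [Eb Q v] is
    injective on the range of [Ea Q'], and [Ea Q v^*] is injective on the range
    of [Eb Q'] for a similar reason ([box_rank]).  This gives rank inequalities
    between a square and a smaller one.  They suffice: if [Eb D] has finite rank
    [n] for an open [D], then [Eb] restricted to [D] is concentrated on finitely
    many points, around each of which a square carries no more than the rank of
    its centre; comparing point by point bounds the rank of [Ea D] by [n]
    ([rank_le_open]).  The equality of the spectra outside [0] is then read off
    on small squares.

    From ranks to the closure.  A separable space has room for only countably
    many vertical or horizontal lines that [Ea] or [Eb] charges ([countable_atoms]).
    So a square grid of small mesh can be drawn whose lines are all null.  The
    open cells, minus [0], exhaust the spectra outside [0] up to null sets, and by
    hypothesis come with partial isometries [v_i] from [Ea Q_i] to [Eb Q_i].  Their sum [v] satisfies [v^* v = p_a], and both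
    [v a v^*] and [b] are within a multiple of the mesh of [sum_i l_i Eb Q_i],
    where [l_i] is a corner of the cell [Q_i] ([block_approx]). *)

(** * The real inner product, and convergence along sequences *)

Section HilbertSpace.
Context (R : realType) (H : completeNormedModType R[i]).
Context (ip : {dot H for (@Num.conj R[i])}).
Hypothesis ip_norm : forall x : H, ip x x = `|x| ^+ 2.
Implicit Types (x y : H) (r s e : R) (D : set (borelC R)) (l : R[i]).

(** Norms and moduli are valued in [R[i]] with zero imaginary part.  Their real
    parts, and the real part of the inner product, bring every estimate into the
    ordered field [R], where [lra] and [nra] apply; [rot] recovers the complex
    structure that [rip] forgets. *)
Definition cabs l : R := complex.Re `|l|.
Definition nrm x : R := complex.Re `|x|.
Definition rip x y : R := complex.Re (ip x y).
Definition rot x : H := (0 +i* 1 : R[i]) *: x.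

Lemma cabsE l : `|l| = (cabs l)%:C.
Proof. by rewrite /cabs RRe_real// normr_real. Qed.

Lemma nrmE x : `|x| = (nrm x)%:C.
Proof. by rewrite /nrm RRe_real// normr_real. Qed.

Lemma nrm_ge0 x : 0 <= nrm x.
Proof. by rewrite -lecR -nrmE normr_ge0. Qed.

Lemma nrm0 : nrm 0 = 0.
Proof. by rewrite /nrm normr0. Qed.

Lemma nrm_eq0 x : nrm x = 0 -> x = 0.
Proof. by move=> x0; apply: normr0_eq0; rewrite nrmE x0. Qed.

Lemma nrmD x y : nrm (x + y) <= nrm x + nrm y.
Proof. by rewrite -lecR rmorphD/= -!nrmE ler_normD. Qed.

Lemma nrmN x : nrm (- x) = nrm x.
Proof. by rewrite /nrm normrN. Qed.

Lemma nrmBC x y : nrm (x - y) = nrm (y - x).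
Proof. by rewrite /nrm distrC. Qed.

Lemma nrmB x y : nrm (x - y) <= nrm x + nrm y.
Proof. by rewrite (le_trans (nrmD _ _))// nrmN. Qed.

Lemma nrm_triB x y z : nrm (x - z) <= nrm (x - y) + nrm (y - z).
Proof. by rewrite (le_trans _ (nrmD _ _))// subrKA. Qed.

Lemma nrmZ l x : nrm (l *: x) = cabs l * nrm x.
Proof.
apply: (@complexI R); have := normrZ l x; rewrite cabsE !nrmE => ->.
by rewrite rmorphM.
Qed.

Lemma nrmZr r x : nrm (r%:C *: x) = `|r| * nrm x.
Proof. by rewrite nrmZ /cabs normc_def/= expr0n/= addr0 sqrtr_sqr. Qed.

Lemma ip_nrm x : ip x x = (nrm x ^+ 2)%:C.
Proof. by rewrite ip_norm nrmE rmorphXn. Qed.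

Lemma rip_nrm x : rip x x = nrm x ^+ 2.
Proof. by rewrite /rip ip_nrm. Qed.

Lemma ip_conj x y : ip y x = Num.conj (ip x y).
Proof. by rewrite hermC /= expr0 mul1r. Qed.

Lemma ripC x y : rip x y = rip y x.
Proof. by rewrite /rip ip_conj; case: (ip y x). Qed.

Lemma ripDl x y z : rip (x + y) z = rip x z + rip y z.
Proof. by rewrite /rip linearDl/=; case: (ip x z); case: (ip y z). Qed.

Lemma ripDr x y z : rip z (x + y) = rip z x + rip z y.
Proof. by rewrite !(ripC z) ripDl. Qed.

Lemma ripZl r x y : rip (r%:C *: x) y = r * rip x y.
Proof.
by rewrite /rip linearZl_LR/=; case: (ip x y) => a b /=; rewrite mul0r subr0.
Qed.

Lemma ripZr r x y : rip x (r%:C *: y) = r * rip x y.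
Proof. by rewrite ripC ripZl ripC. Qed.

Lemma ripNl x y : rip (- x) y = - rip x y.
Proof. by rewrite /rip linearNl/=; case: (ip x y). Qed.

Lemma ripNr x y : rip x (- y) = - rip x y.
Proof. by rewrite ripC ripNl ripC. Qed.

Lemma ripBl x y z : rip (x - y) z = rip x z - rip y z.
Proof. by rewrite ripDl ripNl. Qed.

Lemma ripBr x y z : rip z (x - y) = rip z x - rip z y.
Proof. by rewrite ripDr ripNr. Qed.

Lemma rip0l y : rip 0 y = 0.
Proof. by rewrite /rip linear0l. Qed.

Lemma rip0r y : rip y 0 = 0.
Proof. by rewrite ripC rip0l. Qed.

Lemma rip_rotl x y : rip (rot x) y = - complex.Im (ip x y).
Proof.
by rewrite /rip /rot linearZl_LR/=; case: (ip x y) => a b /=;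
  rewrite mul0r sub0r mul1r.
Qed.

Lemma rotrot x : rot (rot x) = - x.
Proof.
rewrite /rot scalerA -scaleN1r; congr (_ *: _).
by apply/eqP; rewrite eq_complex /= !mulr0 !mul0r !mulr1 sub0r addr0 oppr0 !eqxx.
Qed.

Lemma nrm_rot x : nrm (rot x) = nrm x.
Proof.
by rewrite nrmZ /cabs normc_def/= expr0n/= add0r expr1n sqrtr1 mul1r.
Qed.

Lemma rotD x y : rot (x + y) = rot x + rot y.
Proof. by rewrite /rot scalerDr. Qed.

Lemma rotN x : rot (- x) = - rot x.
Proof. by rewrite /rot scalerN. Qed.

Lemma rotB x y : rot (x - y) = rot x - rot y.
Proof. by rewrite rotD rotN. Qed.

Lemma rip_rot x y : rip (rot x) (rot y) = rip x y.
Proof.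
rewrite /rip /rot linearZl_LR linearZr_LR/=.
case: (ip x y) => a b; rewrite /conjc/= !mul0r !mul1r.
by rewrite !(sub0r, subr0, add0r, addr0) mulN1r opprK.
Qed.

Lemma ip_rip x y : ip x y = rip x y +i* - rip (rot x) y.
Proof. by rewrite rip_rotl /rip opprK; case: (ip x y). Qed.

Lemma nrm_add_sqr x y : nrm (x + y) ^+ 2 = nrm x ^+ 2 + nrm y ^+ 2 + 2 * rip x y.
Proof. by rewrite -!rip_nrm ripDl !ripDr (ripC y x); ring. Qed.

Lemma nrm_sub_sqr x y : nrm (x - y) ^+ 2 = nrm x ^+ 2 + nrm y ^+ 2 - 2 * rip x y.
Proof. by rewrite nrm_add_sqr nrmN ripNr; ring. Qed.

(** Cauchy-Schwarz is the triangle inequality of the given norm, squared. *)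
Lemma rip_le x y : rip x y <= nrm x * nrm y.
Proof.
have : nrm (x + y) ^+ 2 <= (nrm x + nrm y) ^+ 2.
  by rewrite lerXn2r ?nnegrE ?addr_ge0 ?nrm_ge0 ?nrmD.
by rewrite nrm_add_sqr; lra.
Qed.

Lemma rip_eq0 x : (forall y, rip x y = 0) -> x = 0.
Proof.
by move=> /(_ x); rewrite rip_nrm => /eqP; rewrite sqrf_eq0 => /eqP /nrm_eq0.
Qed.

Lemma rip_ext x y : (forall z, rip x z = rip y z) -> x = y.
Proof.
by move=> xy; apply/subr0_eq/rip_eq0 => z; rewrite ripBl xy subrr.
Qed.

Lemma ipDl x y z : ip (x + y) z = ip x z + ip y z.
Proof. exact: linearDl. Qed.

Lemma ipNl x z : ip (- x) z = - ip x z.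
Proof. exact: linearNl. Qed.

Lemma ipZl l x z : ip (l *: x) z = l * ip x z.
Proof. exact: linearZl_LR. Qed.

Lemma ipDr x y z : ip z (x + y) = ip z x + ip z y.
Proof. exact: linearDr. Qed.

Lemma ipZr l x z : ip z (l *: x) = Num.conj l * ip z x.
Proof. exact: linearZr_LR. Qed.

Lemma ip0l z : ip 0 z = 0.
Proof. exact: linear0l. Qed.

Lemma ip_ext x y : (forall z, ip x z = ip y z) -> x = y.
Proof. by move=> xy; apply: rip_ext => z; rewrite /rip xy. Qed.

(** Convergence with a real epsilon, to avoid the order of [R[i]]. *)
Definition cvH (u : nat -> H) x :=
  forall e, 0 < e -> exists N, forall n, (N <= n)%N -> nrm (u n - x) < e.

Lemma cvg_cvH (u : nat -> H) x : u n @[n --> \oo] --> x -> cvH u x.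
Proof.
move=> /cvgrPdist_lt uc e e0.
have [|N _ hN] := uc e%:C; first by rewrite ltcR.
by exists N => n Nn; have := hN n Nn; rewrite nrmE ltcR nrmBC.
Qed.

Lemma cvH_cvg (u : nat -> H) x : cvH u x -> u n @[n --> \oo] --> x.
Proof.
move=> uc; apply/cvgrPdist_lt => e e0.
have er : e = (complex.Re e)%:C by rewrite RRe_real// gtr0_real.
have [|N hN] := uc (complex.Re e); first by rewrite -ltcR -er.
by exists N => // n Nn /=; rewrite er nrmE ltcR nrmBC; exact: hN.
Qed.

Lemma cvH_unique u x y : cvH u x -> cvH u y -> x = y.
Proof.
by move=> /cvH_cvg ux /cvH_cvg uy; exact: (cvg_unique (@norm_hausdorff _ H) ux uy).
Qed.

Lemma cauchy_cvH (u : nat -> H) :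
  (forall e, 0 < e -> exists N, forall m n, (N <= m)%N -> (N <= n)%N ->
     nrm (u m - u n) < e) -> exists x, cvH u x.
Proof.
move=> uC; exists (lim (u n @[n --> \oo])).
apply: cvg_cvH; apply/cauchy_cvgP; apply/cauchy_ballP => e e0.
have er : e = (complex.Re e)%:C by rewrite RRe_real// gtr0_real.
have [|N hN] := uC (complex.Re e); first by rewrite -ltcR -er.
exists ([set u n | n in [set n | (N <= n)%N]],
        [set u n | n in [set n | (N <= n)%N]]) => /=.
  by split; exists N => // n Nn; exists n.
move=> [y z] /= [[m Nm <-] [n Nn <-]].
by rewrite -ball_normE /= er nrmE ltcR; exact: hN.
Qed.

Lemma cvHD u v x y : cvH u x -> cvH v y -> cvH (fun n => u n + v n) (x + y).
Proof. by move=> /cvH_cvg ux /cvH_cvg vy; apply: cvg_cvH; exact: cvgD. Qed.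

Lemma cvHZ l u x : cvH u x -> cvH (fun n => l *: u n) (l *: x).
Proof. by move=> /cvH_cvg ux; apply: cvg_cvH; exact: cvgZr. Qed.

Definition bounded (f : H -> H) :=
  exists2 M : R, 0 < M & forall x, nrm (f x) <= M * nrm x.

Lemma bop_bounded (f : bop H) : bounded f.
Proof.
have /linear_bounded_continuous /linear_boundedP [M [Mr hM]] := @bop_continuous _ _ f.
have Me : M = (complex.Re M)%:C by rewrite RRe_real.
pose m := `|complex.Re M| + 1.
exists m; first by rewrite ltr_wpDl.
move=> x; rewrite -lecR rmorphM/= -!nrmE; apply: hM.
by rewrite Me ltcR /m (le_lt_trans (ler_norm _))// ltrDl.
Qed.

Lemma bounded_continuous (f : {linear H -> H}) : bounded f -> continuous f.
Proof.
move=> [M M0 hM]; apply: bounded_linear_continuous; apply/linear_boundedP.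
exists M%:C; split; first by apply/complex_realP; exists M.
move=> r Mr x; rewrite (@le_trans _ _ (M%:C * `|x|))//.
  by rewrite !nrmE -rmorphM/= lecR hM.
by rewrite ler_wpM2r// ltW.
Qed.

(** A bounded operator is a record over packed linear maps, so every operator
    built below by a formula is obtained through this existence statement. *)
Lemma bop_of (f : H -> H) : (forall l x y, f (l *: x + y) = l *: f x + f y) ->
  bounded f -> exists g : bop H, forall x, g x = f x.
Proof.
move=> fl fb.
pose A := GRing.isLinear.Build R[i] H H *:%R f fl.
pose F : {linear H -> H} := HB.pack f A.
have Fc : continuous F by apply: bounded_continuous.
by exists (BOp Fc).
Qed.

Lemma closureP (A : set H) x : closure A x <->
  (forall e, 0 < e -> exists2 y, A y & nrm (x - y) < e).
Proof.
split=> [cA e e0|hA B].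
  have [|y [Ay]] := cA (ball x e%:C); first by apply: nbhsx_ballx; rewrite ltcR.
  by rewrite -ball_normE/= nrmE ltcR => h; exists y.
rewrite -nbhs_ballE => -[e /= e0 hB].
have er : e = (complex.Re e)%:C by rewrite RRe_real// gtr0_real.
have [|y Ay yx] := hA (complex.Re e); first by rewrite -ltcR -er.
by exists y; split => //; apply: hB; rewrite -ball_normE/= er nrmE ltcR.
Qed.

Lemma dense_seq : separable H ->
  exists d : nat -> H, forall x e, 0 < e -> exists n, nrm (x - d n) < e.
Proof.
move=> [D [cD dD]].
have dn x e : 0 < e -> exists2 y, D y & nrm (x - y) < e.
  move=> e0; have [||y []] := dD (ball x e%:C).
  - by exists x; apply: ballxx; rewrite ltcR.
  - exact: ball_open.
  by rewrite -ball_normE/= nrmE ltcR => h Dy; exists y.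
have /countable_injP [g ginj] := cD.
have /choice [f hf] : forall n, exists y, forall z, D z -> g z = n -> y = z.
  move=> n; case: (pselect (exists2 z, D z & g z = n)) => [[z Dz gz]|nz].
    by exists z => w Dw gw; apply: ginj; rewrite ?inE// gz gw.
  by exists 0 => z Dz gz; case: nz; exists z.
exists f => x e /(dn x)[y Dy xy]; exists (g y).
by rewrite (hf _ _ Dy erefl).
Qed.

(** Linear identities in [H] become identities between complex numbers once they
    are paired with an arbitrary vector, and then [ring] decides them. *)
Ltac vec := apply: ip_ext => ?; rewrite ?(ipDl, ipNl, ipZl, ip0l); ring.

(** * Fixed points: resolvents and coercive operators *)

Lemma cabs_ge0 l : 0 <= cabs l.
Proof. by rewrite -lecR -cabsE normr_ge0. Qed.

Lemma cabsN l : cabs (- l) = cabs l.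
Proof. by rewrite /cabs normrN. Qed.

Lemma cabsV l : cabs l^-1 = (cabs l)^-1.
Proof. by apply: (@complexI R); rewrite fmorphV -!cabsE normfV. Qed.

Lemma cabs_real r : cabs r%:C = `|r|.
Proof. by rewrite /cabs normc_def/= expr0n/= addr0 sqrtr_sqr. Qed.

Lemma cabs_sqr l : cabs l ^+ 2 = complex.Re l ^+ 2 + complex.Im l ^+ 2.
Proof. by apply: (@complexI R); rewrite add_Re2_Im2 cabsE -rmorphXn. Qed.

Lemma cabs_Re l : `|complex.Re l| <= cabs l.
Proof. by rewrite -lecR -cabsE normc_ge_Re. Qed.

Lemma cabs_Im l : `|complex.Im l| <= cabs l.
Proof.
rewrite -(@ler_pXn2r _ 2)// ?nnegrE ?cabs_ge0// cabs_sqr real_normK ?num_real//.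
by rewrite lerDr sqr_ge0.
Qed.

Lemma fixed_point (phi : H -> H) q : 0 <= q -> q < 1 ->
  (forall x y, nrm (phi x - phi y) <= q * nrm (x - y)) -> exists x, phi x = x.
Proof.
move=> q0 q1 hphi; pose u n := iter n phi 0.
have q1' : 0 < 1 - q by rewrite subr_gt0.
pose K := nrm (phi 0) / (1 - q).
have K0 : 0 <= K by rewrite divr_ge0 ?nrm_ge0// ltW.
have uK n : nrm (u n) <= K.
  elim: n => [|n IH]; first by rewrite nrm0.
  have := nrm_triB (u n.+1) (phi 0) 0; rewrite !subr0 => /le_trans; apply.
  have -> : K = q * K + nrm (phi 0).
    by rewrite /K; field; rewrite gt_eqF.
  rewrite lerD2r (le_trans (hphi _ _))// subr0.
  by rewrite ler_wpM2l.
have um m k : nrm (u (m + k)%N - u m) <= q ^+ m * K.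
  elim: m => [|m IH]; first by rewrite expr0 mul1r subr0 uK.
  by rewrite addSn exprS -mulrA (le_trans (hphi _ _))// ler_wpM2l.
have qK e : 0 < e -> exists N, q ^+ N * K < e.
  move=> e0; have q1n : `|q| < 1 by rewrite ger0_norm.
  have := @cvg_expr _ q q1n => /cvgrPdist_lt /(_ (e / (K + 1))) [|N _ /(_ N)].
    by rewrite divr_gt0// ltr_wpDl.
  move=> /(_ (leqnn _)); rewrite sub0r normrN ger0_norm ?exprn_ge0// => h.
  exists N; move: h; rewrite ltr_pdivlMr ?ltr_wpDl//; apply: le_lt_trans.
  by rewrite ler_wpM2l ?exprn_ge0// lerDl.
have [x ux] : exists x, cvH u x.
  apply: cauchy_cvH => e e0.
  have [N hN] := qK (e / 2) (divr_gt0 e0 (ltr0Sn _ 1)).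
  exists N => m n Nm Nn.
  have := nrm_triB (u m) (u N) (u n).
  have := um N (m - N)%N; have := um N (n - N)%N; rewrite !subnKC//.
  by rewrite (nrmBC (u N)); lra.
exists x; apply: (@cvH_unique (fun n => u n.+1)).
  move=> e e0; have [N hN] := ux e e0; exists N => n Nn.
  apply: le_lt_trans (hN n Nn); rewrite (le_trans (hphi _ _))//.
  by rewrite ler_piMl ?nrm_ge0// ltW.
move=> e e0; have [N hN] := ux e e0; exists N => n Nn.
by apply: hN; rewrite (leq_trans Nn).
Qed.

Lemma neumann (k : bop H) q : 0 <= q -> q < 1 ->
  (forall x, nrm (k x) <= q * nrm x) -> forall y, exists x, x - k x = y.
Proof.
move=> q0 q1 hk y; have [x xE] : exists x, y + k x = x.
  apply: (@fixed_point _ q) => // z w.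
  by rewrite opprD addrACA subrr add0r -linearB hk.
by exists x; rewrite -{1}xE addrK.
Qed.

Lemma shift_lin (a : bop H) l m x y :
  a (m *: x + y) - l *: (m *: x + y) = m *: (a x - l *: x) + (a y - l *: y).
Proof. by rewrite linearP; vec. Qed.

Lemma shift_sub (a : bop H) l x y :
  a (x - y) - l *: (x - y) = (a x - l *: x) - (a y - l *: y).
Proof. by rewrite linearB/=; vec. Qed.

(** Being bounded below makes the inverse both single-valued and bounded. *)
Lemma resolvent (a : bop H) l r : 0 < r ->
  (forall x, r * nrm x <= nrm (a x - l *: x)) ->
  (forall y, exists x, a x - l *: x = y) -> ~ spectrum a l.
Proof.
move=> r0 hr /choice[g hg]; apply; have inj x y : a x - l *: x = a y - l *: y -> x = y.
  move=> axy; apply/subr0_eq/nrm_eq0/eqP; rewrite eq_le nrm_ge0 andbT.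
  rewrite -(pmulr_rle0 _ r0) (le_trans (hr _))//.
  by rewrite shift_sub axy subrr nrm0.
have [||G GE] := @bop_of g.
- by move=> m x y; apply: inj; rewrite shift_lin !hg.
- exists r^-1; rewrite ?invr_gt0// => y.
  by rewrite mulrC ler_pdivlMr// mulrC -{2}(hg y).
exists G; split=> x; rewrite !GE ?hg//.
by apply: inj; rewrite hg.
Qed.

Lemma shift_bop (a : bop H) l : exists f : bop H, forall x, f x = a x - l *: x.
Proof.
apply: bop_of => [m x y|]; first exact: shift_lin.
have [M M0 hM] := bop_bounded a.
exists (M + cabs l); first by rewrite ltr_wpDr// cabs_ge0.
by move=> x; rewrite (le_trans (nrmB _ _))// nrmZ mulrDl lerD.
Qed.

Lemma scale_bop (a : bop H) l : exists f : bop H, forall x, f x = l *: a x.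
Proof.
apply: bop_of => [m x y|].
  by rewrite linearP scalerDr !scalerA mulrC.
have [M M0 hM] := bop_bounded a.
exists ((cabs l + 1) * M); first by rewrite mulr_gt0// ltr_wpDl// cabs_ge0.
move=> x; rewrite nrmZ -mulrA ler_pM ?nrm_ge0 ?cabs_ge0//.
by rewrite lerDl.
Qed.

(** For [|l|] above a bound of [a], the equation [a x - l x = y] reads
    [x - l^-1 a x = - l^-1 y], a Neumann equation. *)
Lemma spectrum_bounded (a : bop H) : exists2 M, 0 < M &
  forall l, spectrum a l -> cabs l <= M.
Proof.
have [M M0 hM] := bop_bounded a; exists M => // l; apply: contraPle => Ml.
have l0 : 0 < cabs l by rewrite (lt_trans M0).
have lneq : l != 0.
  by apply/eqP => l0'; move: l0; rewrite l0' (cabs_real 0) normr0 ltxx.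
apply: (@resolvent _ _ (cabs l - M)); first by rewrite subr_gt0.
  move=> x; have := nrm_triB (l *: x) (a x) 0; rewrite !subr0 nrmZ (nrmBC (_ *: _)).
  by move: (hM x); rewrite mulrBl; lra.
move=> y; have [f fE] := scale_bop a l^-1.
have [|||x hx] := @neumann f (M / cabs l) _ _ _ (- l^-1 *: y).
- by rewrite divr_ge0// ltW.
- by rewrite ltr_pdivrMr// mul1r.
- move=> x; rewrite fE nrmZ cabsV mulrAC mulrC.
  by rewrite ler_wpM2r// invr_ge0 cabs_ge0.
exists x; move/(congr1 (fun z => - l *: z)) : hx.
rewrite fE scalerBr !scalerA mulrNN !mulNr mulfV// scaleN1r scale1r opprK addrC.
by rewrite scaleNr.
Qed.

(** If [c] inverts [a - l], the equation [a x - m x = y] is equivalent to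
    [x - (m - l) c x = c y], a Neumann equation for [m] close to [l].  Closedness
    makes the spectrum a Borel set, on which [E] is multiplicative. *)
Lemma spectrum_closed (a : bop H) : closed (spectrum a).
Proof.
rewrite -openC openE => l /contrapT [c [ca ac]].
have [M M0 hM] := bop_bounded c.
exists (2 * M)^-1%:C => /=; first by rewrite ltcR invr_gt0 mulr_gt0.
move=> m; rewrite /= cabsE ltcR => lm.
have lM : cabs (m - l) * M < 1 / 2.
  by rewrite -cabsN opprB -ltr_pdivlMr// -mulrA mul1r -invfM.
have hml x : M * nrm ((m - l) *: x) <= 1 / 2 * nrm x.
  by rewrite nrmZ mulrA (mulrC M) ler_wpM2r ?nrm_ge0// ltW.
apply: (@resolvent _ _ (2 * M)^-1); first by rewrite invr_gt0 mulr_gt0.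
  move=> x; rewrite mulrC ler_pdivrMr ?mulr_gt0//.
  have := hM (a x - l *: x); rewrite ca.
  have := nrmD (a x - m *: x) ((m - l) *: x).
  have -> : a x - m *: x + (m - l) *: x = a x - l *: x by vec.
  move=> h1 h2; have := ler_wpM2l (ltW M0) h1.
  by have := hml x; lra.
move=> y; have [f fE] := scale_bop c (m - l).
have [||x|x hx] := @neumann f (1 / 2) _ _ _ (c y).
- by lra.
- by lra.
- rewrite fE -linearZ (le_trans (hM _))// hml.
exists x; move/(congr1 (fun z => a z - l *: z)) : hx.
rewrite ac fE shift_sub -linearZ ac => <-; vec.
Qed.

(** A coercive operator on the range of [P] is onto it: for small [t > 0] the map
    [x |-> x - t (l T x - y)] contracts, since its square norm picks up the term
    [- 2 t r] to first order and only [t^2 M^2] to second order.  The unimodular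
    [l] selects the direction in which the values of the form are positive. *)
Lemma lax_milgram (T P : bop H) l r : 0 < r ->
  (forall x, P (P x) = P x) -> (forall x, nrm (P x) <= nrm x) ->
  (forall x, P (T x) = T (P x)) ->
  (forall x, P x = x -> r * nrm x ^+ 2 <= rip (l *: T x) x) ->
  forall y, P y = y -> exists x, T x = y.
Proof.
move=> r0 PP P1 PT hT y Py.
have [f fE] := scale_bop T l.
have [M0 M00 hM0] := bop_bounded f.
pose M := M0 + r.
have M_gt0 : 0 < M by rewrite addr_gt0.
have hM x : nrm (f x) <= M * nrm x.
  by rewrite (le_trans (hM0 _))// ler_wpM2r ?nrm_ge0// lerDl ltW.
have Pf x : P (f x) = f (P x) by rewrite !fE linearZ PT.
(* This t minimizes 1 - 2 t r + t^2 M^2, the squared contraction ratio. *)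
pose t := r / M ^+ 2.
have t0 : 0 < t by rewrite divr_gt0// exprn_gt0.
have tM : t * M ^+ 2 = r by rewrite /t divfK// gt_eqF// exprn_gt0.
have rM : r ^+ 2 <= M ^+ 2.
  by rewrite ler_sqr ?nnegrE ?(ltW r0) ?(ltW M_gt0)// lerDr ltW.
have tr : t * r <= 1 by rewrite /t mulrAC -expr2 ler_pdivrMr ?exprn_gt0// mul1r.
pose q := Num.sqrt (1 - t * r).
have q2 : q ^+ 2 = 1 - t * r by rewrite sqr_sqrtr// subr_ge0.
have q0 : 0 <= q by exact: sqrtr_ge0.
have [||x hx] := @fixed_point (fun x => P x - t%:C *: (f (P x) - y)) q q0.
- rewrite -(@ltr_pXn2r _ 2)// ?nnegrE// q2 expr1n.
  by rewrite ltrBlDl ltrDr mulr_gt0.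
- move=> x1 x2.
  have -> : P x1 - t%:C *: (f (P x1) - y) - (P x2 - t%:C *: (f (P x2) - y)) =
      P (x1 - x2) - t%:C *: f (P (x1 - x2)).
    by rewrite !linearB/=; vec.
  set w := x1 - x2.
  rewrite (@le_trans _ _ (q * nrm (P w)))//; last by rewrite ler_wpM2l.
  rewrite -(@ler_pXn2r _ 2)// ?nnegrE ?mulr_ge0 ?nrm_ge0//.
  rewrite exprMn q2 nrm_sub_sqr nrmZr ger0_norm ?(ltW t0)// ripZr exprMn.
  have h1 : nrm (f (P w)) ^+ 2 <= M ^+ 2 * nrm (P w) ^+ 2.
    by rewrite -exprMn ler_sqr ?nnegrE ?mulr_ge0 ?nrm_ge0// ltW.
  have h2 := hT (P w) (PP w); rewrite -fE ripC in h2.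
  have h3 := ler_wpM2l (ltW t0) h2.
  have h4 := ler_wpM2l (sqr_ge0 t) h1.
  have h5 : t ^+ 2 * (M ^+ 2 * nrm (P w) ^+ 2) = t * (r * nrm (P w) ^+ 2).
    by rewrite -tM; ring.
  by rewrite h5 in h4; lra.
have {}hx : f (P x) = y.
  have := congr1 P hx; rewrite linearB linearZ linearB/= PP Pf PP Py => {}hx.
  have /eqP : t%:C *: (f (P x) - y) = 0.
    by rewrite -[_ *: _](subKr (P x)) hx subrr.
  rewrite scaler_eq0 -[0 in X in X || _]/(0%:C) (inj_eq (@complexI R)) gt_eqF//.
  by rewrite subr_eq0 => /eqP.
by exists (l *: P x); rewrite linearZ/= -fE.
Qed.

(** * Borel sets of the plane and spectral measures *)

Lemma proj_idem (P : bop H) x : orth_proj ip P -> P (P x) = P x.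
Proof. by case=> h _; exact: h. Qed.

Lemma proj_rip (P : bop H) x y : orth_proj ip P -> rip (P x) y = rip x (P y).
Proof. by case=> _ h; rewrite /rip h. Qed.

Lemma proj_sqr (P : bop H) x : orth_proj ip P -> nrm (P x) ^+ 2 = rip (P x) x.
Proof. by move=> hP; rewrite -rip_nrm proj_rip// proj_idem// ripC. Qed.

Lemma proj_le (P : bop H) x : orth_proj ip P -> nrm (P x) <= nrm x.
Proof.
move=> hP; have [->|x0] := eqVneq (nrm (P x)) 0; first exact: nrm_ge0.
have Px0 : 0 < nrm (P x) by rewrite lt_neqAle eq_sym x0 nrm_ge0.
by rewrite -(ler_pM2l Px0) -expr2 proj_sqr// rip_le.
Qed.

(** The real part, the imaginary part and the distance to a point are all
    1-Lipschitz, hence Borel; every set of the plane below is cut out by them. *)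
Definition lip1 (f : R[i] -> R) := forall z w, `|f z - f w| <= cabs (z - w).

Lemma lip1_Re : lip1 (@complex.Re R).
Proof. by move=> z w; rewrite -raddfB cabs_Re. Qed.

Lemma lip1_Im : lip1 (@complex.Im R).
Proof. by move=> z w; rewrite -raddfB cabs_Im. Qed.

Lemma lip1_cabs : lip1 cabs.
Proof.
have h z w : cabs z <= cabs (z - w) + cabs w.
  by rewrite -lecR rmorphD/= -!cabsE -{1}(subrK w z) ler_normD.
move=> z w; rewrite ler_norml; have := h z w; have := h w z.
by rewrite -(cabsN (w - z)) opprB; lra.
Qed.

Lemma lip1_continuous f : lip1 f -> continuous (f : plane R -> R).
Proof.
move=> hf; suff : continuous (f : R[i]^o -> R) by [].
move=> z; apply/(@cvgrPdist_lt _ _ _ (nbhs z)) => e e0.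
exists e%:C => /=; first by rewrite ltcR.
move=> w; rewrite /= cabsE ltcR; apply: le_lt_trans; exact: hf.
Qed.

Lemma open_preim f (A : set R) : lip1 f -> open A -> open (f @^-1` A : set (plane R)).
Proof. by move=> /lip1_continuous hf; apply: open_comp => z _; exact: hf. Qed.

Lemma open_borel (D : set (plane R)) : open D -> measurable (D : set (borelC R)).
Proof. by move=> oD; exact: sub_sigma_algebra. Qed.

Lemma closed_borel (D : set (plane R)) : closed D -> measurable (D : set (borelC R)).
Proof. by rewrite -openC => /open_borel /measurableC; rewrite setCK. Qed.

Lemma lip1_measurable f : lip1 f -> measurable_fun setT (f : borelC R -> R).
Proof.
move=> hf.
apply: (@measurability _ _ (borelC R) (measurableTypeR R) _ _ _
  (RGenOpens.measurableE R)) => _ [_ [x [y ->]] <-].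
rewrite setTI; apply: open_borel; apply: open_preim => //; exact: interval_open.
Qed.

Lemma borel_preim f (A : set R) : lip1 f -> measurable A ->
  measurable (f @^-1` A : set (borelC R)).
Proof. by move=> hf mA; rewrite -[X in measurable X]setTI; exact: lip1_measurable. Qed.

Lemma borel1 z : measurable ([set z] : set (borelC R)).
Proof.
have -> : [set z] = (fun w => cabs (w - z)) @^-1` [set` `]-oo, 0]].
  apply/seteqP; split => w /=.
    by move=> ->; rewrite subrr in_itv/= (cabs_real 0) normr0.
  rewrite in_itv/= => h; apply/subr0_eq/eqP; rewrite -normr_eq0 cabsE.
  have -> : cabs (w - z) = 0 by apply/eqP; rewrite eq_le h cabs_ge0.
  by [].
apply: borel_preim => //; move=> u v /=; rewrite (le_trans (lip1_cabs _ _))//.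
by rewrite opprB addrA subrK.
Qed.

Lemma disc_borel M : measurable ([set z | cabs z <= M] : set (borelC R)).
Proof.
have -> : [set z | cabs z <= M] = cabs @^-1` [set` `]-oo, M]].
  by apply/seteqP; split => z /=; rewrite in_itv.
by apply: borel_preim => //; exact: lip1_cabs.
Qed.

Section spectral.
Variables (a : bop H) (E : set (borelC R) -> bop H).
Hypothesis sm : spectral_measure ip a E.

Lemma spm_orth D : measurable D -> orth_proj ip (E D).
Proof. exact: (spm_proj sm). Qed.

Lemma spmI D1 D2 x : measurable D1 -> measurable D2 ->
  E (D1 `&` D2) x = E D1 (E D2 x).
Proof. by move=> m1 m2; exact: (spm_setI sm m1 m2). Qed.

Lemma spm_idem D x : measurable D -> E D (E D x) = E D x.
Proof. by move=> mD; rewrite -spmI// setIid. Qed.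

Lemma spm_sub D1 D2 x : measurable D1 -> measurable D2 -> D1 `<=` D2 ->
  E D1 x = x -> E D2 x = x.
Proof. by move=> m1 m2 D12 h; rewrite -h -spmI// setIC setIidl. Qed.

(** The scalar measure of [x] has mass [|E D x|^2] on [D]; null sets of [E] are
    handled through it, with the measure theory of positive measures. *)
Lemma spm_mu x : exists2 mu : {measure set (borelC R) -> \bar R},
  (forall D, measurable D -> mu D = (nrm (E D x) ^+ 2)%:E) &
  ip (a x) x = (\int[mu]_z complex.Re z) +i* (\int[mu]_z complex.Im z).
Proof.
have [mu h1 h2] := spm_integral sm x; exists mu => // D mD.
by rewrite h1// proj_sqr//; exact: spm_orth.
Qed.

Lemma spm0 x : E set0 x = 0.
Proof.
have [mu hmu _] := spm_mu x; have := hmu set0 measurable0.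
by rewrite measure0 => -[] /esym/eqP; rewrite sqrf_eq0 => /eqP/nrm_eq0.
Qed.

Lemma spm_disj D1 D2 x : measurable D1 -> measurable D2 -> D1 `&` D2 = set0 ->
  E D1 (E D2 x) = 0.
Proof. by move=> m1 m2 d; rewrite -spmI// d spm0. Qed.

Lemma spm_null (F : nat -> set (borelC R)) D x : measurable D ->
  (forall n, measurable (F n)) -> D `<=` \bigcup_n F n ->
  (forall n, E (F n) x = 0) -> E D x = 0.
Proof.
move=> mD mF DF h; have [mu hmu _] := spm_mu x.
have : (mu D <= \sum_(0 <= n <oo) mu (F n))%E by exact: measure_sigma_subadditive.
rewrite eseries0 => [|n _ _]; last by rewrite hmu// h nrm0 expr0n.
rewrite hmu// lee_fin => h0; apply/nrm_eq0/eqP.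
by rewrite -sqrf_eq0 eq_le h0 sqr_ge0.
Qed.

Lemma spmU D1 D2 x : measurable D1 -> measurable D2 -> D1 `&` D2 = set0 ->
  E (D1 `|` D2) x = E D1 x + E D2 x.
Proof.
move=> m1 m2 d; have mU : measurable (D1 `|` D2) by exact: measurableU.
have d' : D2 `&` D1 = set0 by rewrite setIC.
apply/subr0_eq; set z := _ - _.
have z1 : E D1 z = 0.
  by rewrite /z linearB linearD/= -spmI// setIUr setIid d setU0 spm_idem//
    spm_disj// addr0 subrr.
have z2 : E D2 z = 0.
  by rewrite /z linearB linearD/= -spmI// setIUr setIid d' set0U spm_idem//
    spm_disj// add0r subrr.
have <- : E (D1 `|` D2) z = z.
  rewrite /z linearB linearD/= spm_idem//.
  congr (_ - (_ + _)).
    by rewrite -spmI// setIidr// => ?; left.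
  by rewrite -spmI// setIidr// => ?; right.
apply: (@spm_null (bigcup2 D1 D2)) => //.
- by move=> [|[|n]] /=.
- by rewrite bigcup2E.
- by move=> [|[|n]] //=; rewrite spm0.
Qed.

Lemma spm_setC D x : measurable D -> E (~` D) x = x - E D x.
Proof.
move=> mD; have mC := measurableC mD.
have := @spmU D (~` D) x mD mC (setICr _).
by rewrite setUv (spm_setT sm) /= => {2}->; rewrite addrC addKr.
Qed.

Lemma spm_compl D x : measurable D -> E D x = x -> E (~` D) x = 0.
Proof. by move=> mD h; rewrite spm_setC// h subrr. Qed.

Lemma spm_pythagoras D x : measurable D ->
  nrm x ^+ 2 = nrm (E D x) ^+ 2 + nrm (E (~` D) x) ^+ 2.
Proof.
move=> mD; rewrite spm_setC// nrm_sub_sqr.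
by rewrite (ripC x) -proj_sqr; [ring|exact: spm_orth].
Qed.

(** The only use of the axiom that [E] is carried by the spectrum: without it the
    integrals of the two coordinates could diverge. *)
Lemma spm_bounded_support : exists2 M, 0 < M &
  forall x, E [set z | cabs z <= M] x = x.
Proof.
have [M M0 hM] := spectrum_bounded a; exists M => // x.
apply: (@spm_sub (spectrum a)) => //.
- by apply: closed_borel; exact: spectrum_closed.
- exact: disc_borel.
exact: (spm_spectrum sm).
Qed.

Lemma spm_integrable (mu : {measure set (borelC R) -> \bar R}) x f :
  (forall D, measurable D -> mu D = (nrm (E D x) ^+ 2)%:E) ->
  lip1 f -> (forall z, `|f z| <= cabs z) ->
  mu.-integrable setT (EFin \o (f : borelC R -> R)).
Proof.
move=> hmu lf fb; have [M M0 hM] := spm_bounded_support.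
have mf := lip1_measurable lf.
have mK := disc_borel M; set K := [set z | _] in mK.
apply: (iffRL (@negligible_integrable _ _ _ mu setT (~` K) _ _ _ _ _)) => //.
- exact: measurableC.
- exact/measurable_EFinP.
- by rewrite [LHS]hmu ?spm_compl ?nrm0 ?expr0n//; exact: measurableC.
rewrite setTD setCK; apply: measurable_bounded_integrable => //.
- by rewrite hmu// ltry.
- exact: measurable_funS mf.
- exists M; split; first exact: num_real.
  by move=> r Mr z /= zM; rewrite (le_trans (fb z))// (le_trans zM)// ltW.
Qed.

Lemma spm_int_restrict (mu : {measure set (borelC R) -> \bar R}) x f D :
  (forall D, measurable D -> mu D = (nrm (E D x) ^+ 2)%:E) ->
  lip1 f -> (forall z, `|f z| <= cabs z) -> measurable D -> E D x = x ->
  \int[mu]_z f z = \int[mu]_(z in D) f z.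
Proof.
move=> hmu lf fb mD Dx; rewrite /Rintegral (@negligible_integral _ _ _ _ _ (~` D)) //.
- by rewrite setTD setCK.
- exact: measurableC.
- exact: spm_integrable hmu lf fb.
- by rewrite [LHS]hmu ?spm_compl ?nrm0 ?expr0n//; exact: measurableC.
Qed.

Lemma spm_int_ge (mu : {measure set (borelC R) -> \bar R}) x f D s :
  (forall D, measurable D -> mu D = (nrm (E D x) ^+ 2)%:E) ->
  lip1 f -> (forall z, `|f z| <= cabs z) -> measurable D -> E D x = x ->
  (forall z, D z -> s <= f z) -> s * nrm x ^+ 2 <= \int[mu]_z f z.
Proof.
move=> hmu lf fb mD Dx sf; rewrite (@spm_int_restrict mu x f D)//.
have -> : s * nrm x ^+ 2 = \int[mu]_(z in D) (cst s z).
  by rewrite Rintegral_cst// hmu// Dx.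
apply: le_Rintegral => //.
- apply: measurable_bounded_integrable => //.
  + by rewrite hmu// ltry.
  + exists `|s|; split; first exact: num_real.
    by move=> r Mr z /= zM; rewrite ltW.
- by apply: integrableS (spm_integrable hmu lf fb).
Qed.

Lemma spm_int_le (mu : {measure set (borelC R) -> \bar R}) x f D s :
  (forall D, measurable D -> mu D = (nrm (E D x) ^+ 2)%:E) ->
  lip1 f -> (forall z, `|f z| <= cabs z) -> measurable D -> E D x = x ->
  (forall z, D z -> f z <= s) -> \int[mu]_z f z <= s * nrm x ^+ 2.
Proof.
move=> hmu lf fb mD Dx sf; rewrite (@spm_int_restrict mu x f D)//.
have -> : s * nrm x ^+ 2 = \int[mu]_(z in D) (cst s z).
  by rewrite Rintegral_cst// hmu// Dx.
apply: le_Rintegral => //.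
- by apply: integrableS (spm_integrable hmu lf fb).
- apply: measurable_bounded_integrable => //.
  + by rewrite hmu// ltry.
  + exists `|s|; split; first exact: num_real.
    by move=> r Mr z /= zM; rewrite ltW.
Qed.

(** For [x] in the range of [E D] and [y] orthogonal to it, the scalar measure of
    [x + y] coincides with that of [x] on subsets of [D] and with that of [y] on
    subsets of the complement. *)
Lemma spm_int_split (mu mx my : {measure set (borelC R) -> \bar R}) x y f D :
  (forall D, measurable D -> mu D = (nrm (E D (x + y)) ^+ 2)%:E) ->
  (forall D, measurable D -> mx D = (nrm (E D x) ^+ 2)%:E) ->
  (forall D, measurable D -> my D = (nrm (E D y) ^+ 2)%:E) ->
  lip1 f -> (forall z, `|f z| <= cabs z) ->
  measurable D -> E D x = x -> E D y = 0 ->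
  \int[mu]_z f z = \int[mx]_z f z + \int[my]_z f z.
Proof.
move=> hmu hx hy lf fb mD Dx Dy; have mC := measurableC mD.
rewrite (@spm_int_restrict mx x f D)// (@spm_int_restrict my y f (~` D))//; last first.
  by rewrite spm_setC// Dy subr0.
have -> : \int[mx]_(z in D) f z = \int[mu]_(z in D) f z.
  congr fine; apply: eq_measure_integral => A mA AD; rewrite hx// hmu// linearD/=.
  by rewrite -(@setIidl _ A D)// !spmI// Dx Dy linear0 addr0.
have -> : \int[my]_(z in ~` D) f z = \int[mu]_(z in ~` D) f z.
  congr fine; apply: eq_measure_integral => A mA AD; rewrite hy// hmu// linearD/=.
  by rewrite -(@setIidl _ A (~` D))// !spmI// !spm_setC// Dx subrr linear0 add0r.
rewrite -Rintegral_setU ?setUv//.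
- exact: spm_integrable hmu lf fb.
- by apply/disj_setPS; rewrite setICr.
Qed.

End spectral.

(** * Estimates for a - l on spectral subspaces *)

(** Squares rather than discs: membership is a pair of linear conditions on the
    coordinates, matching the bounds on the real and imaginary forms. *)
Definition box l r : set (plane R) :=
  [set z : R[i] | `|complex.Re z - complex.Re l| < r /\
                  `|complex.Im z - complex.Im l| < r].

Lemma box_open l r : open (box l r).
Proof.
have -> : box l r =
    (@complex.Re R @^-1` [set` `]complex.Re l - r, complex.Re l + r[]) `&`
    (@complex.Im R @^-1` [set` `]complex.Im l - r, complex.Im l + r[]).
  by apply/seteqP; split => z; rewrite /box/= !in_itv/= !ltr_distl.
apply: openI; apply: open_preim.
- exact: lip1_Re.
- exact: interval_open.
- exact: lip1_Im.
- exact: interval_open.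
Qed.

Lemma box_borel l r : measurable (box l r : set (borelC R)).
Proof. by apply: open_borel; exact: box_open. Qed.

Lemma box_center l r : 0 < r -> box l r l.
Proof. by move=> r0; split; rewrite subrr normr0. Qed.

Lemma box_le l r s : r <= s -> box l r `<=` box l s.
Proof. by move=> rs z [h1 h2]; split; exact: lt_le_trans rs. Qed.

Lemma invn_lt e : 0 < e -> exists n : nat, n.+1%:R^-1 < e.
Proof.
move=> e0; have [N _ h] := near_infty_natSinv_lt (PosNum e0).
by exists N; exact: (h N (leqnn N)).
Qed.

Lemma box_shrink l z : z != l -> exists n : nat, ~ box l n.+1%:R^-1 z.
Proof.
rewrite eq_complex negb_and => /orP[] zl.
  have [|n hn] := @invn_lt `|complex.Re z - complex.Re l|.
    by rewrite normr_gt0 subr_eq0.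
  by exists n => -[+ _]; rewrite ltNge (ltW hn).
have [|n hn] := @invn_lt `|complex.Im z - complex.Im l|.
  by rewrite normr_gt0 subr_eq0.
by exists n => -[_ +]; rewrite ltNge (ltW hn).
Qed.

Lemma open_box (D : set (plane R)) l : open D -> D l ->
  exists2 r, 0 < r & box l r `<=` D.
Proof.
rewrite openE => /(_ l) oD /oD [e /= e0 hD].
have er : e = (complex.Re e)%:C by rewrite RRe_real// gtr0_real.
have r0 : 0 < complex.Re e by rewrite -ltcR -er.
exists (complex.Re e / 2); first by rewrite divr_gt0.
move=> z [h1 h2]; apply: hD; rewrite /= er cabsE ltcR -(@ltr_pXn2r _ 2)//
  ?nnegrE ?cabs_ge0 ?(ltW r0)//.
rewrite -cabsN opprB cabs_sqr !raddfB/=.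
move: h1 h2; rewrite !ltr_norml => /andP[h1 h2] /andP[h3 h4]; nra.
Qed.

Section estimates.
Variables (a : bop H) (E : set (borelC R) -> bop H).
Hypothesis sm : spectral_measure ip a E.

Lemma im_rot x y : complex.Im (ip x y) = - rip (rot x) y.
Proof. by rewrite rip_rotl opprK. Qed.

Lemma spm_form_split D x y : measurable D -> E D x = x -> E D y = 0 ->
  ip (a (x + y)) (x + y) = ip (a x) x + ip (a y) y.
Proof.
move=> mD Dx Dy.
have [mu hmu ->] := spm_mu sm (x + y).
have [mx hx ->] := spm_mu sm x.
have [my hy ->] := spm_mu sm y.
rewrite (spm_int_split sm hmu hx hy lip1_Re cabs_Re mD Dx Dy).
by rewrite (spm_int_split sm hmu hx hy lip1_Im cabs_Im mD Dx Dy).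
Qed.

(** The cross terms of the form of [a] vanish: additivity of the form on [x + y]
    kills their sum, and on [x + i y] their difference. *)
Lemma spm_cross D x y : measurable D -> E D x = x -> E D y = 0 ->
  ip (a x) y = 0 /\ ip (a y) x = 0.
Proof.
move=> mD Dx Dy.
have h1 : ip (a x) y + ip (a y) x = 0.
  have := spm_form_split mD Dx Dy.
  rewrite (linearD a) ipDl !ipDr.
  move=> /(congr1 (fun u => u - (ip (a x) x + ip (a y) y))).
  by rewrite subrr => <-; ring.
have h2 : ip (a x) y - ip (a y) x = 0.
  have Diy : E D (rot y) = 0 by rewrite /rot linearZ/= Dy scaler0.
  have := spm_form_split mD Dx Diy.
  rewrite (linearD a) ipDl !ipDr /rot (linearZ_LR a)/= !ipZl !ipZr.
  set k := (0 +i* 1); have kk : k * k = -1.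
    by apply/eqP; rewrite eq_complex /k/=; apply/andP; split; apply/eqP; ring.
  have -> : Num.conj k = - k.
    by apply/eqP; rewrite eq_complex /k/=; apply/andP; split; apply/eqP; ring.
  move=> /(congr1 (fun u => k * (u - (ip (a x) x + k * (- k * ip (a y) y))))).
  rewrite subrr mulr0 => h; rewrite -[RHS]h.
  rewrite [RHS](_ : _ = - (k * k) * (ip (a x) y - ip (a y) x)); last by ring.
  by rewrite kk opprK mul1r.
split.
  have : (ip (a x) y + ip (a y) x) + (ip (a x) y - ip (a y) x) = 0.
    by rewrite h1 h2 addr0.
  rewrite addrACA subrr addr0 -mulr2n => /eqP.
  by rewrite mulrn_eq0/= => /eqP.
have : (ip (a x) y + ip (a y) x) - (ip (a x) y - ip (a y) x) = 0.
  by rewrite h1 h2 subr0.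
rewrite opprB addrC addrA subrK -mulr2n => /eqP.
by rewrite mulrn_eq0/= => /eqP.
Qed.

(** By [spm_cross], [a] maps the range of [E D] and its orthogonal into
    themselves. *)
Lemma spm_commute D x : measurable D -> E D (a x) = a (E D x).
Proof.
move=> mD; have mC := measurableC mD.
pose u := E D x; pose v := x - E D x.
have Du : E D u = u by exact: (spm_idem sm _ _).
have Dv : E D v = 0 by rewrite /v linearB/= -/u Du subrr.
have Dau : E (~` D) (a u) = 0.
  apply: rip_eq0 => z; rewrite proj_rip; last exact: (spm_orth sm mC).
  rewrite /rip (spm_cross mD Du _).1//.
  by rewrite -(spmI sm)// setICr (spm0 sm).
have Dav : E D (a v) = 0.
  apply: rip_eq0 => z; rewrite proj_rip; last exact: (spm_orth sm mD).
  rewrite /rip (spm_cross mD _ Dv).2//.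
  exact: (spm_idem sm _ _).
have -> : a x = a u + a v by rewrite -linearD /v addrC subrK.
rewrite linearD/= Dav addr0 -/u; apply/esym/subr0_eq.
by rewrite -(spm_setC sm)// Dau.
Qed.

Lemma spm_re_ge D s x : measurable D -> E D x = x ->
  (forall z, D z -> s <= complex.Re z) -> s * nrm x ^+ 2 <= rip (a x) x.
Proof.
move=> mD Dx sD; have [mu hmu e] := spm_mu sm x; rewrite /rip e/=.
exact: (spm_int_ge sm hmu lip1_Re cabs_Re mD Dx sD).
Qed.

Lemma spm_re_le D s x : measurable D -> E D x = x ->
  (forall z, D z -> complex.Re z <= s) -> rip (a x) x <= s * nrm x ^+ 2.
Proof.
move=> mD Dx sD; have [mu hmu e] := spm_mu sm x; rewrite /rip e/=.
exact: (spm_int_le sm hmu lip1_Re cabs_Re mD Dx sD).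
Qed.

Lemma spm_im_ge D s x : measurable D -> E D x = x ->
  (forall z, D z -> s <= complex.Im z) -> s * nrm x ^+ 2 <= - rip (rot (a x)) x.
Proof.
move=> mD Dx sD; have [mu hmu e] := spm_mu sm x; rewrite -im_rot e/=.
exact: (spm_int_ge sm hmu lip1_Im cabs_Im mD Dx sD).
Qed.

Lemma spm_im_le D s x : measurable D -> E D x = x ->
  (forall z, D z -> complex.Im z <= s) -> - rip (rot (a x)) x <= s * nrm x ^+ 2.
Proof.
move=> mD Dx sD; have [mu hmu e] := spm_mu sm x; rewrite -im_rot e/=.
exact: (spm_int_le sm hmu lip1_Im cabs_Im mD Dx sD).
Qed.

Lemma rip_scale l x : rip (l *: x) x = complex.Re l * nrm x ^+ 2.
Proof.
by rewrite /rip ipZl ip_nrm; case: l => u v /=; rewrite mulr0 subr0.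
Qed.

Lemma rip_rot_scale l x : rip (rot (l *: x)) x = - complex.Im l * nrm x ^+ 2.
Proof.
by rewrite rip_rotl ipZl ip_nrm; case: l => u v /=; rewrite mulr0 add0r mulNr.
Qed.

Lemma rip_shift l x : rip (a x - l *: x) x =
  rip (a x) x - complex.Re l * nrm x ^+ 2.
Proof. by rewrite ripBl rip_scale. Qed.

Lemma rip_rot_shift l x : rip (rot (a x - l *: x)) x =
  rip (rot (a x)) x + complex.Im l * nrm x ^+ 2.
Proof. by rewrite rotB ripBl rip_rot_scale mulNr opprK. Qed.

(** A bounded quadratic form on an invariant subspace bounds the operator:
    polarization gives [Re <T x, y> <= r (|x|^2 + |y|^2)] for [x] and [y] in the
    subspace, and [y] can be taken proportional to [T x]. *)
Lemma numerical_radius (T P : bop H) r : 0 < r ->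
  (forall x, P (T x) = T (P x)) ->
  (forall x, P x = x -> `|rip (T x) x| <= r * nrm x ^+ 2) ->
  (forall x, P x = x -> `|rip (rot (T x)) x| <= r * nrm x ^+ 2) ->
  forall x, P x = x -> nrm (T x) <= 2 * r * nrm x.
Proof.
move=> r0 PT h1 h2.
have key x y : P x = x -> P y = y -> rip (T x) y <= r * (nrm x ^+ 2 + nrm y ^+ 2).
  move=> Px Py.
  have Pry : P (rot y) = rot y by rewrite /rot linearZ/= Py.
  have PD u v : P u = u -> P v = v -> P (u + v) = u + v.
    by move=> Pu Pv; rewrite linearD/= Pu Pv.
  have PB u v : P u = u -> P v = v -> P (u - v) = u - v.
    by move=> Pu Pv; rewrite linearB/= Pu Pv.
  have /ler_normlW := h1 _ (PD _ _ Px Py).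
  have := h1 _ (PB _ _ Px Py); rewrite ler_norml => /andP[+ _].
  have /ler_normlW := h2 _ (PD _ _ Px Pry).
  have := h2 _ (PB _ _ Px Pry); rewrite ler_norml => /andP[+ _].
  have Trot : T (rot y) = rot (T y) by rewrite /rot linearZ.
  rewrite !nrm_add_sqr !nrmN !nrm_rot !linearD !linearN Trot !rotD !rotN !rotrot.
  rewrite !(ripDl, ripDr, ripNl, ripNr, rip_rot).
  nra.
(* The factor 1 / (2 r) balances the two sides: the terms in T x leave
   |T x|^2 / (4 r) <= r |x|^2. *)
move=> x Px; have := key x ((2 * r)^-1%:C *: T x) Px.
rewrite linearZ/= PT Px => /(_ erefl).
rewrite ripZr rip_nrm nrmZr exprMn real_normK ?num_real// exprVn exprMn.
have r20 : 0 < 2 * r by rewrite mulr_gt0.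
rewrite -(ler_pM2l r20) mulrA divff ?gt_eqF// mul1r => h.
rewrite -(@ler_pXn2r _ 2)// ?nnegrE ?mulr_ge0 ?nrm_ge0 ?(ltW r0)//.
have e : 2 * r * (r * ((2 ^+ 2 * r ^+ 2)^-1 * nrm (T x) ^+ 2)) = nrm (T x) ^+ 2 / 2.
  by field; rewrite gt_eqF.
by move: h; rewrite !mulrDr e exprMn exprMn; nra.
Qed.

Lemma spm_upper D l r x : 0 < r -> measurable D ->
  (forall z, D z -> `|complex.Re z - complex.Re l| <= r /\
                    `|complex.Im z - complex.Im l| <= r) ->
  E D x = x -> nrm (a x - l *: x) <= 2 * r * nrm x.
Proof.
move=> r0 mD hD Dx; have [T TE] := shift_bop a l; rewrite -TE.
apply: (@numerical_radius T (E D)) => //.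
- by move=> y; rewrite !TE linearB linearZ/= spm_commute.
- move=> y Dy; rewrite TE rip_shift.
  have := @spm_re_ge D (complex.Re l - r) y mD Dy.
  have := @spm_re_le D (complex.Re l + r) y mD Dy.
  rewrite ler_norml => h1 h2; apply/andP; split.
    have : (complex.Re l - r) * nrm y ^+ 2 <= rip (a y) y.
      by apply: h2 => z /hD[+ _]; rewrite ler_norml => /andP[]; lra.
    by lra.
  have : rip (a y) y <= (complex.Re l + r) * nrm y ^+ 2.
    by apply: h1 => z /hD[+ _]; rewrite ler_norml => /andP[]; lra.
  by lra.
- move=> y Dy; rewrite TE rip_rot_shift.
  have := @spm_im_ge D (complex.Im l - r) y mD Dy.
  have := @spm_im_le D (complex.Im l + r) y mD Dy.
  rewrite ler_norml => h1 h2; apply/andP; split.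
    have : - rip (rot (a y)) y <= (complex.Im l + r) * nrm y ^+ 2.
      by apply: h1 => z /hD[_]; rewrite ler_norml => /andP[]; lra.
    by lra.
  have : (complex.Im l - r) * nrm y ^+ 2 <= - rip (rot (a y)) y.
    by apply: h2 => z /hD[_]; rewrite ler_norml => /andP[]; lra.
  by lra.
Qed.

Lemma spm_upper_box l r x : 0 < r -> E (box l r) x = x ->
  nrm (a x - l *: x) <= 2 * r * nrm x.
Proof.
move=> r0; apply: spm_upper => //; first exact: box_borel.
by move=> z [/ltW h1 /ltW h2].
Qed.

(** The preimage in the second clause is not asked to be in the range of [E D];
    this makes the property pass to disjoint unions by adding preimages. *)
Definition invertible_on l r D := [/\ measurable D,
  forall x, E D x = x -> r * nrm x <= nrm (a x - l *: x) &
  forall y, E D y = y -> exists x, a x - l *: x = y].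

(** The two pieces are orthogonal and stable under [a], so the squared norms add
    up on both sides of the lower bound. *)
Lemma invertible_split l r D A : 0 < r -> measurable D -> measurable A ->
  invertible_on l r (D `&` A) -> invertible_on l r (D `\` A) -> invertible_on l r D.
Proof.
move=> r0 mD mA [m1 b1 s1] [m2 b2 s2].
have DE : (D `&` A) `|` (D `\` A) = D by rewrite setUIDK.
have dis : (D `&` A) `&` (D `\` A) = set0.
  by apply/seteqP; split => // z [[_ ?] [_]].
have dec x : E D x = E (D `&` A) x + E (D `\` A) x.
  by rewrite -(spmU sm)// DE.
have [T TE] := shift_bop a l.
have ET B x : measurable B -> E B (T x) = T (E B x).
  by move=> mB; rewrite !TE linearB linearZ/= spm_commute.
split => // [x Dx|y Dy].
  rewrite -TE -(@ler_pXn2r _ 2)// ?nnegrE ?mulr_ge0 ?nrm_ge0 ?(ltW r0)//.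
  rewrite exprMn (spm_pythagoras sm x m1) (spm_pythagoras sm (T x) m1).
  have e2 : E (~` (D `&` A)) x = E (D `\` A) x.
    by rewrite (spm_setC sm)// -{1}Dx dec addrC addKr.
  rewrite !ET//; last exact: measurableC.
  rewrite e2 mulrDr -!exprMn lerD// ler_pXn2r// ?nnegrE
    ?mulr_ge0 ?nrm_ge0 ?(ltW r0)// TE.
    by apply: b1; exact: (spm_idem sm _ _).
  by apply: b2; exact: (spm_idem sm _ _).
have [x1 hx1] := s1 _ (spm_idem sm y m1).
have [x2 hx2] := s2 _ (spm_idem sm y m2).
by exists (x1 + x2); rewrite -Dy dec -hx1 -hx2 -!TE linearD.
Qed.

(** Lower bound by Cauchy-Schwarz, surjectivity by [lax_milgram]. *)
Lemma invertible_half l r D k : 0 < r -> measurable D -> cabs k = 1 ->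
  (forall x, E D x = x -> r * nrm x ^+ 2 <= rip (k *: (a x - l *: x)) x) ->
  invertible_on l r D.
Proof.
move=> r0 mD k1 hD; have [T TE] := shift_bop a l.
split => // [x Dx|y Dy].
  have [->|x0] := eqVneq (nrm x) 0; first by rewrite mulr0 nrm_ge0.
  have nx0 : 0 < nrm x by rewrite lt_neqAle eq_sym x0 nrm_ge0.
  rewrite -(ler_pM2r nx0) -mulrA -expr2 (le_trans (hD x Dx))//.
  by rewrite (le_trans (rip_le _ _))// nrmZ k1 mul1r.
have [||||x hx] := @lax_milgram T (E D) k r r0 _ _ _ _ y Dy.
- by move=> x; exact: (spm_idem sm _ _).
- by move=> x; apply: proj_le; exact: (spm_orth sm mD).
- by move=> x; rewrite !TE linearB linearZ/= spm_commute.
- by move=> x Dx; rewrite TE hD.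
by exists x; rewrite -TE.
Qed.

(** The complement of a square is the union of four half-planes, and on each of
    them one of the four forms [Re <k (a - l) x, x>] with [k^4 = 1] is coercive. *)
Lemma invertible_away l r D : 0 < r -> measurable D ->
  (forall z, D z -> ~ box l r z) -> invertible_on l r D.
Proof.
move=> r0 mD hD.
pose A1 : set (borelC R) := @complex.Re R @^-1` [set` `[complex.Re l + r, +oo[].
pose A2 : set (borelC R) := @complex.Re R @^-1` [set` `]-oo, complex.Re l - r]].
pose A3 : set (borelC R) := @complex.Im R @^-1` [set` `[complex.Im l + r, +oo[].
have m1 : measurable A1 by apply: borel_preim => //; exact: lip1_Re.
have m2 : measurable A2 by apply: borel_preim => //; exact: lip1_Re.
have m3 : measurable A3 by apply: borel_preim => //; exact: lip1_Im.
apply: (invertible_split r0 mD m1).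
  apply: (@invertible_half _ _ _ 1) => //; first exact: measurableI.
    by rewrite (cabs_real 1) normr1.
  move=> x Dx; rewrite scale1r rip_shift.
  have : (complex.Re l + r) * nrm x ^+ 2 <= rip (a x) x.
    by apply: (spm_re_ge _ Dx) => [|z [_]];
      [exact: measurableI|rewrite /A1/= in_itv/= andbT].
  by lra.
have mD1 := measurableD mD m1.
apply: (invertible_split r0 mD1 m2).
  apply: (@invertible_half _ _ _ (-1)) => //; first exact: measurableI.
    by rewrite cabsN (cabs_real 1) normr1.
  move=> x Dx; rewrite scaleN1r ripNl rip_shift.
  have : rip (a x) x <= (complex.Re l - r) * nrm x ^+ 2.
    by apply: (spm_re_le _ Dx) => [|z [_]]; [exact: measurableI|rewrite /A2/= in_itv].
  by lra.
have mD2 := measurableD mD1 m2.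
apply: (invertible_split r0 mD2 m3).
  apply: (@invertible_half _ _ _ (0 -i* 1)) => //; first exact: measurableI.
    by rewrite /cabs normc_def/= expr0n/= add0r sqrrN expr1n sqrtr1.
  move=> x Dx.
  have -> : (0 -i* 1) *: (a x - l *: x) = - rot (a x - l *: x).
    have -> : (0 -i* 1) = - (0 +i* 1) :> R[i].
      by apply/eqP; rewrite eq_complex/= oppr0 !eqxx.
    by rewrite scaleNr.
  rewrite ripNl rip_rot_shift.
  have : (complex.Im l + r) * nrm x ^+ 2 <= - rip (rot (a x)) x.
    by apply: (spm_im_ge _ Dx) => [|z [_]];
      [exact: measurableI|rewrite /A3/= in_itv/= andbT].
  by lra.
have mD3 := measurableD mD2 m3.
apply: (@invertible_half _ _ _ (0 +i* 1)) => //.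
  by rewrite /cabs normc_def/= expr0n/= add0r expr1n sqrtr1.
move=> x Dx; rewrite -/(rot _) rip_rot_shift.
have : - rip (rot (a x)) x <= (complex.Im l - r) * nrm x ^+ 2.
  apply: (spm_im_le mD3 Dx) => z [[[Dz]]].
  rewrite /A1/A2/A3/= !in_itv/= !andbT => h1 h2 h3.
  rewrite leNgt; apply/negP => h4; apply: (hD z Dz); rewrite /box/=.
  by rewrite !ltr_norml; move/negP: h1; move/negP: h2; move/negP: h3;
    rewrite -!ltNge => h3 h2 h1; split; apply/andP; split; lra.
by lra.
Qed.

Lemma spm_lower l r D x : 0 < r -> measurable D ->
  (forall z, D z -> ~ box l r z) -> E D x = x -> r * nrm x <= nrm (a x - l *: x).
Proof. by move=> r0 mD /(invertible_away r0 mD) [_ h _]; exact: h. Qed.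

Lemma spectrumP l : spectrum a l <->
  forall r, 0 < r -> exists x, E (box l r) x <> 0.
Proof.
split => [sl r r0|hl [c [ca _]]].
  apply: contrapT => /forallNP h.
  have mC := measurableC (box_borel l r).
  have [|_ b s] := @invertible_away l r (~` box l r) r0 mC => //.
  have all x : E (~` box l r) x = x.
    rewrite (spm_setC sm); last exact: box_borel.
    by have /contrapT -> := h x; rewrite subr0.
  by apply: (resolvent r0 _ _ sl) => // x; [apply: b|apply: s].
have [M M0 hM] := bop_bounded c.
have r0 : 0 < (4 * M)^-1 by rewrite invr_gt0 mulr_gt0.
have [x] := hl _ r0; apply.
set y := E _ x; have yy : E (box l (4 * M)^-1) y = y.
  by apply: (spm_idem sm _ _); exact: box_borel.
have := spm_upper_box r0 yy; have := hM (a y - l *: y); rewrite ca => h1 h2.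
have := le_trans h1 (ler_wpM2l (ltW M0) h2).
have -> : M * (2 * (4 * M)^-1 * nrm y) = nrm y / 2 by field; rewrite gt_eqF.
move=> h3; apply: nrm_eq0; have := nrm_ge0 y; lra.
Qed.

Lemma spm_kernel x : E [set 0] x = x -> a x = 0.
Proof.
move=> x0; apply/nrm_eq0/eqP; rewrite eq_le nrm_ge0 andbT.
apply/ler_addgt0Pr => e e0; rewrite add0r.
have r0 : 0 < e / (2 * (nrm x + 1)).
  by rewrite divr_gt0// mulr_gt0// ltr_wpDl ?nrm_ge0.
have := @spm_upper _ 0 _ x r0 (borel1 _) _ x0.
rewrite scale0r subr0 => /(_ _)/le_trans; apply.
  by move=> z ->; rewrite !subrr normr0; split; exact: ltW.
have n1 : 0 < nrm x + 1 by rewrite ltr_wpDl ?nrm_ge0.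
have -> : 2 * (e / (2 * (nrm x + 1))) * nrm x = e * (nrm x / (nrm x + 1)).
  by field; rewrite gt_eqF.
rewrite ler_piMr ?(ltW e0)// ler_pdivrMr// mul1r lerDl//.
Qed.

Lemma spm_range x : E (~` [set 0]) (a x) = a x.
Proof.
have m0 := borel1 (0 : R[i]).
rewrite (spm_setC sm)// spm_commute//.
by rewrite (@spm_kernel (E _ x)) ?subr0//; exact: (spm_idem sm _ _).
Qed.

(** The complement of [0] is the increasing union of the complements of the
    squares of half-side [1 / (n + 1)]; on each difference [a] is onto, so the
    partial sums of [E] over these annuli land in the range of [a]. *)
Lemma spm_range_proj : range_proj ip a (E (~` [set 0])).
Proof.
have m0 := borel1 (0 : R[i]); have mC := measurableC m0.
have hP := spm_orth sm mC.
split => //; apply/seteqP; split => y.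
  move=> [x _ <-]; apply/closureP => e e0.
  pose F n : set (borelC R) := ~` box 0 n.+1%:R^-1.
  have mF n : measurable (F n) by apply: measurableC; exact: box_borel.
  have ndF : nondecreasing_seq F.
    move=> m n mn; apply/subsetPset/subsetC/box_le.
    by rewrite lef_pV2 ?posrE ?ltr0Sn// ler_nat.
  have mA n : measurable (seqD F n) by case: n => [|n] //=; apply: measurableD.
  have UA : \bigcup_n seqD F n = ~` [set 0].
    rewrite eq_bigcup_seqD; apply/seteqP; split => z.
      move=> [n _ Fz] /= z0; apply: Fz; rewrite z0.
      by apply: box_center; rewrite invr_gt0.
    by move=> /eqP /box_shrink[n hn]; exists n.
  have h n : exists u, a u = E (seqD F n) x.
    have r0 : 0 < n.+1%:R^-1 :> R by rewrite invr_gt0.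
    have [|_ _ s] := @invertible_away 0 _ (seqD F n) r0 (mA n).
      by case: (n) => [|m] z //= [].
    have [u hu] := s _ (spm_idem sm x (mA n)).
    by exists u; rewrite -hu scale0r subr0.
  have [u hu] := choice h.
  have := spm_sigma_additive sm mA (trivIset_seqD ndF) (x := x).
  rewrite UA => /cvg_cvH /(_ e e0) [N /(_ N (leqnn _)) sN].
  exists (a (\sum_(0 <= i < N) u i)); first by exists (\sum_(0 <= i < N) u i).
  by rewrite nrmBC linear_sum/=; under eq_bigr do rewrite hu.
move=> /closureP h; exists y => //; apply/subr0_eq/nrm_eq0/eqP.
rewrite eq_le nrm_ge0 andbT; apply/ler_addgt0Pr => e e0; rewrite add0r.
have [|_ [x _ <-] xy] := h (e / 2); first by rewrite divr_gt0.
have := nrm_triB (E (~` [set 0]) y) (a x) y; rewrite -{1}spm_range -linearB/=.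
have := proj_le (y - a x) hP; rewrite (nrmBC (a x)); lra.
Qed.

End estimates.

(** * Orthonormal bases and equivalence of projections *)

Lemma cvH_rip_eq2 u w x z y y' : cvH u x -> cvH w z ->
  (forall n, rip (u n) y = rip y' (w n)) -> rip x y = rip y' z.
Proof.
move=> ux wz h; apply/eqP; rewrite -subr_eq0 -normr_le0.
apply/ler_addgt0Pr => e e0.
pose K := nrm y + nrm y' + 1.
have K0 : 0 < K by rewrite ltr_wpDl// addr_ge0 ?nrm_ge0.
have [M hM] := ux (e / K) (divr_gt0 e0 K0).
have [N hN] := wz (e / K) (divr_gt0 e0 K0).
pose n := maxn M N.
have h1 := ltW (hM n (leq_maxl _ _)); have h2 := ltW (hN n (leq_maxr _ _)).
have -> : rip x y - rip y' z = rip (x - u n) y + rip y' (w n - z).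
  by rewrite ripBl ripBr h; ring.
have b1 : `|rip (x - u n) y| <= e / K * nrm y.
  rewrite ler_norml lerNl -ripNl; apply/andP; split; rewrite (le_trans (rip_le _ _))//.
    by rewrite opprB ler_wpM2r ?nrm_ge0.
  by rewrite nrmBC ler_wpM2r ?nrm_ge0.
have b2 : `|rip y' (w n - z)| <= e / K * nrm y'.
  rewrite ler_norml lerNl -ripNr.
  apply/andP; split; rewrite (le_trans (rip_le _ _))// mulrC.
    by rewrite nrmN ler_wpM2r ?nrm_ge0.
  by rewrite ler_wpM2r ?nrm_ge0.
rewrite add0r (le_trans (ler_normD _ _))// (le_trans (lerD b1 b2))//.
rewrite -mulrDr mulrAC ler_pdivrMr// ler_wpM2l ?(ltW e0)//.
by rewrite /K lerDl.
Qed.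

Lemma cvH_nrm_le2 u w x z : cvH u x -> cvH w z ->
  (forall n, nrm (u n) <= nrm (w n)) -> nrm x <= nrm z.
Proof.
move=> ux wz h; apply/ler_addgt0Pr => e e0.
have e20 : 0 < e / 2 by rewrite divr_gt0.
have [M hM] := ux _ e20; have [N hN] := wz _ e20.
have h1 := hM _ (leq_maxl M N); have h2 := hN _ (leq_maxr M N).
have := h (maxn M N).
have := nrm_triB x (u (maxn M N)) 0; rewrite !subr0 nrmBC.
have := nrm_triB (w (maxn M N)) z 0; rewrite !subr0.
lra.
Qed.

(** Partial sums of the partial isometry that sends [e k] to [f k]; with [f = e]
    they are those of the projection onto the span of [e]. *)
Definition psum (e f : nat -> H) n x : H := \sum_(0 <= k < n) ip x (e k) *: f k.

Definition orthseq (e : nat -> H) := forall i j, i <> j -> ip (e i) (e j) = 0.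

Lemma nrm_osum (e : nat -> H) (c : nat -> R[i]) m n : orthseq e ->
  ip (\sum_(m <= k < n) c k *: e k) (\sum_(m <= k < n) c k *: e k) =
  \sum_(m <= k < n) c k * Num.conj (c k) * ip (e k) (e k).
Proof.
move=> oe; elim: n => [|n IH].
  by rewrite !big_geq// ip0l.
have [mn|nm] := leqP m n; last by rewrite !big_geq// ip0l.
rewrite !big_nat_recr//= ipDl !ipDr IH.
have h : ip (\sum_(m <= k < n) c k *: e k) (c n *: e n) = 0.
  rewrite linear_sumlz big_nat_cond big1// => k /andP[/andP[_ kn] _].
  by rewrite /= ipZl ipZr oe ?mulr0// => kn'; rewrite kn' ltnn in kn.
by rewrite h ip_conj h rmorph0 addr0 add0r ipZl ipZr mulrA.
Qed.

Lemma psum_tail (e f : nat -> H) m n x : (m <= n)%N ->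
  psum e f n x - psum e f m x = \sum_(m <= k < n) ip x (e k) *: f k.
Proof. by move=> mn; rewrite /psum (big_cat_nat (n := m))//= addrAC subrr add0r. Qed.

(** The sums along [e] and along [f] have equal norms, so the convergence of the
    projection onto the span of [e] makes the partial isometry converge. *)
Lemma psum_isom (e f : nat -> H) m n x : orthseq e -> orthseq f ->
  (forall k, ip (e k) (e k) = ip (f k) (f k)) -> (m <= n)%N ->
  nrm (psum e f n x - psum e f m x) = nrm (psum e e n x - psum e e m x).
Proof.
move=> oe of_ ef mn; rewrite !psum_tail//; apply/eqP.
rewrite -(@eqrXn2 _ 2)// ?nrm_ge0//; apply/eqP/(@complexI R).
rewrite -!ip_nrm !nrm_osum//.
by apply: eq_bigr => k _; rewrite ef.
Qed.

Lemma psum_bop (e f : nat -> H) (P : bop H) : orthseq e -> orthseq f ->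
  (forall k, ip (e k) (e k) = ip (f k) (f k)) ->
  orth_proj ip P -> (forall x, cvH (fun n => psum e e n x) (P x)) ->
  exists V : bop H, (forall x, cvH (fun n => psum e f n x) (V x)) /\
    (forall x, nrm (V x) = nrm (P x)).
Proof.
move=> oe of_ ef hP eP.
have cV x : exists y, cvH (fun n => psum e f n x) y.
  apply: cauchy_cvH => r r0.
  have [N hN] := eP x (r / 2) (divr_gt0 r0 (ltr0Sn _ 1)).
  exists N => m n Nm Nn.
  wlog mn : m n Nm Nn / (m <= n)%N => [hw|].
    by have [mn|/ltnW nm] := leqP m n; [|rewrite nrmBC]; apply: hw.
  rewrite nrmBC psum_isom//.
  have := nrm_triB (psum e e n x) (P x) (psum e e m x).
  by rewrite (nrmBC (P x)); have := hN _ Nm; have := hN _ Nn; lra.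
have [V0 hV0] := choice cV.
have nV x : nrm (V0 x) = nrm (P x).
  have eqn n : nrm (psum e f n x) = nrm (psum e e n x).
    have := @psum_isom e f 0 n x oe of_ ef (leq0n _).
    by rewrite /psum !(big_geq (leqnn 0))// !subr0.
  apply/eqP; rewrite eq_le; apply/andP; split.
    by apply: (cvH_nrm_le2 (hV0 x) (eP x)) => n; rewrite eqn.
  by apply: (cvH_nrm_le2 (eP x) (hV0 x)) => n; rewrite eqn.
have [||V VE] := @bop_of V0.
- move=> l x y; apply: (cvH_unique (hV0 _)).
  have -> : (fun n => psum e f n (l *: x + y)) =
            (fun n => l *: psum e f n x + psum e f n y).
    apply/funext => n; rewrite /psum scaler_sumr -big_split/=.
    by apply: eq_bigr => k _; rewrite ipDl ipZl scalerDl scalerA.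
  by apply: cvHD => //; exact: cvHZ.
- by exists 1 => // x; rewrite nV mul1r proj_le.
by exists V; split => x; rewrite VE.
Qed.

Lemma psum_adjoint (e f : nat -> H) n x y : ip (psum e f n x) y = ip x (psum f e n y).
Proof.
rewrite /psum linear_sumlz linear_sumr; apply: eq_bigr => k _.
by rewrite /= ipZl ipZr -ip_conj mulrC.
Qed.

(** The imaginary part of the inner product is the real part after [rot], and
    operators commute with [rot]. *)
Lemma adjoint_of_rip (V W : bop H) : (forall x y, rip (V x) y = rip x (W y)) ->
  is_adjoint ip V W.
Proof.
move=> h x y; rewrite !ip_rip h; congr (_ +i* - _).
by rewrite -h /rot linearZ.
Qed.

Lemma isom_rip (V P : bop H) x y : (forall x, nrm (V x) = nrm (P x)) ->
  rip (V x) (V y) = rip (P x) (P y).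
Proof.
move=> h; have := nrm_add_sqr (V x) (V y); have := nrm_add_sqr (P x) (P y).
by rewrite -!linearD !h => ->; lra.
Qed.

(** The two partial isometries are limits of partial sums, and their adjunction
    passes to the limit.  The composite is [P] because a map with the norms of [P]
    also has its real inner products, by polarization.  The squared norms are
    only required to match, so that the sequences may be padded with zeros. *)
Lemma mvn_of_bases (e f : nat -> H) (P Q : bop H) :
  orth_proj ip P -> orth_proj ip Q -> orthseq e -> orthseq f ->
  (forall k, ip (e k) (e k) = ip (f k) (f k)) ->
  (forall x, cvH (fun n => psum e e n x) (P x)) ->
  (forall x, cvH (fun n => psum f f n x) (Q x)) -> mvn_equiv ip P Q.
Proof.
move=> hP hQ oe of_ ef eP fQ.
have [V [cV nV]] := psum_bop oe of_ ef hP eP.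
have [W [cW nW]] := psum_bop of_ oe (fun k => esym (ef k)) hQ fQ.
have adj x y : rip (V x) y = rip x (W y).
  by apply: (cvH_rip_eq2 (cV x) (cW y)) => n; rewrite /rip psum_adjoint.
exists V, W; split; first exact: adjoint_of_rip.
  move=> x; apply: rip_ext => z /=.
  by rewrite ripC -adj (isom_rip _ _ nV) -proj_rip// proj_idem// proj_rip// ripC.
move=> x; apply: rip_ext => z /=.
by rewrite adj (isom_rip _ _ nW) -proj_rip// proj_idem.
Qed.

(** Gram-Schmidt for the range of [f], along a fixed dense sequence.  At each stage
    the residual projection is applied to the first vector of the sequence that
    it does not kill, so no index is wasted: the [n]-th basis vector is [0]
    exactly when the rank is at most [n].  Residuals are plain functions because
    they are built by recursion; [projlike] collects what makes them
    projections. *)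

Variable d : nat -> H.
Hypothesis dense_d : forall x e, 0 < e -> exists n, nrm (x - d n) < e.

Definition pick_unit (f : H -> H) : H :=
  match pselect (exists n, f (d n) != 0) with
  | left h => let y := f (d (ex_minn h)) in (nrm y)^-1%:C *: y
  | right _ => 0
  end.

Fixpoint residual (f : H -> H) n : H -> H :=
  if n is m.+1 then fun x =>
    let e := pick_unit (residual f m) in residual f m x - ip x e *: e
  else f.

Definition basis f n := pick_unit (residual f n).

Definition projlike (f : H -> H) := [/\ forall l x y, f (l *: x + y) = l *: f x + f y,
  forall x, f (f x) = f x & forall x y, ip (f x) y = ip x (f y)].

Lemma projlike_of (P : bop H) : orth_proj ip P -> projlike P.
Proof.
move=> hP; split => [l x y|x|x y]; first exact: linearP.
  exact: proj_idem.
by case: hP.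
Qed.

Lemma projlike0 f : projlike f -> f 0 = 0.
Proof.
by case=> h _ _; have := h (-1) 0 0; rewrite !scaler0 addr0 scaleN1r addNr.
Qed.

Lemma projlikeZ f l x : projlike f -> f (l *: x) = l *: f x.
Proof.
by move=> hf; case: (hf) => h _ _; rewrite -[l *: x]addr0 h projlike0// addr0.
Qed.

Lemma projlikeB f x y : projlike f -> f (x - y) = f x - f y.
Proof.
by case=> h _ _; rewrite addrC -scaleN1r h scaleN1r addrC.
Qed.

Lemma projlike_le f x : projlike f -> nrm (f x) <= nrm x.
Proof.
move=> hf; case: (hf) => _ ff fs.
have [->|x0] := eqVneq (nrm (f x)) 0; first exact: nrm_ge0.
have Px0 : 0 < nrm (f x) by rewrite lt_neqAle eq_sym x0 nrm_ge0.
rewrite -(ler_pM2l Px0) -expr2 -rip_nrm.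
by rewrite /rip -fs ff -/(rip _ _) rip_le.
Qed.

Lemma pick_unitP f : projlike f -> let e := pick_unit f in
  f e = e /\ (nrm e = 1 \/ e = 0 /\ forall x, f x = 0).
Proof.
move=> hf; rewrite /pick_unit; case: pselect => [h|h] /=.
  case: ex_minnP => m fm _; case: (hf) => _ ff _.
  rewrite projlikeZ// ff; split => //; left.
  have m0 : nrm (f (d m)) != 0.
    by apply: contraNneq fm => /nrm_eq0 ->.
  by rewrite nrmZr ger0_norm ?invr_ge0 ?nrm_ge0// mulVf.
rewrite projlike0//; split => //; right; split => // x.
have fd n : f (d n) = 0.
  by apply/eqP; apply: contrapT => fn; apply: h; exists n; apply/negP.
apply/nrm_eq0/eqP; rewrite eq_le nrm_ge0 andbT; apply/ler_addgt0Pr => e e0.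
rewrite add0r; have [n /ltW hn] := dense_d x e0.
by rewrite -[f x]subr0 -(fd n) -projlikeB// (le_trans (projlike_le _ hf)).
Qed.

Lemma pick_unit_sq f : projlike f ->
  ip (pick_unit f) (pick_unit f) *: pick_unit f = pick_unit f.
Proof.
move=> /pick_unitP[_ [h|[-> _]]]; last by rewrite scaler0.
by rewrite ip_nrm h expr1n scale1r.
Qed.

Lemma residual_projlike f n : projlike f -> projlike (residual f n).
Proof.
move=> hf; elim: n => [|n IH] //=.
have [fe _] := pick_unitP IH; have ee := pick_unit_sq IH.
set e := pick_unit _ in fe ee *; set g := residual f n in IH fe *.
case: (IH) => gl gg gs; split => [l x y|x|x y].
- by rewrite gl ipDl ipZl; vec.
- rewrite projlikeB// projlikeZ// gg fe.
  rewrite ipDl ipNl ipZl gs fe.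
  rewrite scalerBl -scalerA ee; vec.
by rewrite ipDl ipNl ipZl ipDr linearNr/= ipZr gs -ip_conj (mulrC (ip e y)).
Qed.

Lemma residual_basis f n : projlike f ->
  residual f n (basis f n) = basis f n.
Proof. by move=> hf; have [] := pick_unitP (residual_projlike n hf). Qed.

Lemma residual_basis0 f i j : projlike f -> (i < j)%N -> residual f j (basis f i) = 0.
Proof.
move=> hf; elim: j => [//|j IH]; rewrite ltnS leq_eqVlt => /orP[/eqP <-|ij] /=.
  rewrite -/(basis f i) residual_basis// pick_unit_sq ?subrr//.
  exact: residual_projlike.
rewrite -/(basis f j) IH// -(residual_basis j hf).
have [_ _ <-] := residual_projlike j hf.
by rewrite IH// ip0l scale0r subrr.
Qed.

Lemma basis_orth f : projlike f -> orthseq (basis f).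
Proof.
move=> hf; have key i j : (i < j)%N -> ip (basis f i) (basis f j) = 0.
  move=> ij; rewrite -(residual_basis j hf).
  by have [_ _ <-] := residual_projlike j hf; rewrite residual_basis0// ip0l.
move=> i j /eqP; rewrite neq_ltn => /orP[|ji]; first exact: key.
by rewrite ip_conj key// rmorph0.
Qed.

Lemma residualE f n x : residual f n x = f x - psum (basis f) (basis f) n x.
Proof.
elim: n => [|n IH] /=; first by rewrite /psum big_geq// subr0.
by rewrite IH /psum big_nat_recr//= opprD addrA.
Qed.

Lemma residual_range f n x : projlike f -> f (residual f n x) = residual f n x.
Proof.
move=> hf; case: (hf) => _ ff _; elim: n x => [//|n IH] x /=.
have fb : f (basis f n) = basis f n.
  by rewrite -(residual_basis n hf) IH.
by rewrite -/(basis f n) projlikeB// projlikeZ// IH fb.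
Qed.

Lemma basis_range f n : projlike f -> f (basis f n) = basis f n.
Proof.
by move=> hf; rewrite -{1}(residual_basis n hf) residual_range// residual_basis.
Qed.

(** The vector picked at stage [n] has index at least [n], and after the stage its
    own residual is [0]. *)
Lemma residual_dense f i n : projlike f -> (i < n)%N -> residual f n (d i) = 0.
Proof.
move=> hf; elim: n i => [//|n IH] i; rewrite ltnS => ni.
have hn := residual_projlike n hf.
rewrite /= /pick_unit; case: pselect => [h|h]; last first.
  rewrite linear0r scaler0 subr0; apply/eqP; apply: contrapT => fi.
  by apply: h; exists i; apply/negP.
case: ex_minnP => m fm hm.
have [->|im] := eqVneq i m; last first.
  have i0 : residual f n (d i) = 0.
    move: ni; rewrite leq_eqVlt => /orP[/eqP ni|]; last exact: IH.
    apply/eqP; apply: contraNT im => /hm mi; rewrite eqn_leq mi andbT ni.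
    by rewrite leqNgt; apply: contra fm => /IH ->.
  have [_ _ gs] := hn.
  by rewrite i0 sub0r ipZr -gs i0 ip0l mulr0 scale0r oppr0.
have [_ gg gs] := hn; set y := residual f n (d m) in fm *.
have y0 : nrm y != 0 by apply: contraNneq fm => /nrm_eq0 ->.
rewrite ipZr; have -> : ip (d m) y = (nrm y ^+ 2)%:C.
  by rewrite -ip_nrm /y -{1}gg gs.
rewrite scalerA -[Num.conj _]/(conjc _) conjc_real -!rmorphM/=.
have -> : (nrm y)^-1 * nrm y ^+ 2 * (nrm y)^-1 = 1 by field.
by rewrite scale1r subrr.
Qed.

Lemma basis_cvg f x : projlike f ->
  cvH (fun n => psum (basis f) (basis f) n x) (f x).
Proof.
move=> hf e e0; have [i hi] := dense_d x e0; exists i.+1 => n ni.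
rewrite nrmBC -residualE.
have hn := residual_projlike n hf.
rewrite -[residual _ _ _]subr0 -(residual_dense hf ni) -projlikeB//.
by rewrite (le_lt_trans (projlike_le _ hn)).
Qed.

(** * Rank of a projection *)

(** Finitely many linear functionals that separate the points of the range: this
    form of the bound pulls back along injective maps and adds up along direct
    sums without any choice of basis. *)
Definition rank_le (P : bop H) n := exists f : {linear H -> 'rV[R[i]]_n},
  forall x, P x = x -> f x = 0 -> x = 0.

Lemma rank_le_pullback (P Q : bop H) (J : {linear H -> H}) n :
  (forall x, P x = x -> Q (J x) = J x) ->
  (forall x, P x = x -> J x = 0 -> x = 0) -> rank_le Q n -> rank_le P n.
Proof.
move=> hQ hJ [f hf]; exists (f \o J) => x Px /= fx.
by apply: hJ => //; apply: hf => //; exact: hQ.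
Qed.

Lemma rank_le_mono (P Q : bop H) n : (forall x, P x = x -> Q x = x) ->
  rank_le Q n -> rank_le P n.
Proof. by move=> h; apply: (@rank_le_pullback P Q idfun). Qed.

Lemma rank_le_add (P P1 P2 : bop H) m k :
  (forall x, P1 (P1 x) = P1 x) -> (forall x, P2 (P2 x) = P2 x) ->
  (forall x, P x = P1 x + P2 x) -> rank_le P1 m -> rank_le P2 k ->
  rank_le P (m + k).
Proof.
move=> i1 i2 hP [f1 h1] [f2 h2].
pose g x := row_mx (f1 (P1 x)) (f2 (P2 x)).
have gl l x y : g (l *: x + y) = l *: g x + g y.
  by rewrite /g !linearP/= scale_row_mx add_row_mx.
pose A := GRing.isLinear.Build R[i] H 'rV[R[i]]_(m + k) *:%R g gl.
pose G : {linear H -> 'rV[R[i]]_(m + k)} := HB.pack g A.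
exists G => x Px /= gx.
have [e1 e2] : f1 (P1 x) = 0 /\ f2 (P2 x) = 0.
  by move: gx; rewrite /G/= /g -[0 in RHS]row_mx0 => /eq_row_mx.
by rewrite -Px hP (h1 _ (i1 x) e1) (h2 _ (i2 x) e2) addr0.
Qed.

(** Functionals on [n + 1] independent vectors form a matrix with more rows than
    columns, hence with a nontrivial left kernel. *)
Lemma rank_le_orthonormal (P : bop H) n (g : 'I_n.+1 -> H) :
  (forall i, P (g i) = g i) ->
  (forall i j, ip (g i) (g j) = (i == j)%:R) -> ~ rank_le P n.
Proof.
move=> Pg og [f hf].
pose M := \matrix_(i < n.+1, j < n) f (g i) 0 j.
have : kermx M != 0.
  rewrite -mxrank_eq0 mxrank_ker subn_eq0 -ltnNge ltnS.
  exact: rank_leq_col.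
move=> /rowV0Pn[c /sub_kermxP cM c0].
pose x := \sum_i c 0 i *: g i.
have x0 : x = 0.
  apply: hf.
    by rewrite /x linear_sum; apply: eq_bigr => i _; rewrite linearZ/= Pg.
  transitivity (c *m M); last exact: cM.
  rewrite /x linear_sum/= mulmx_sum_row.
  apply: eq_bigr => i _; rewrite linearZ/=; congr (_ *: _).
  by apply/rowP => j; rewrite !mxE.
move/eqP: c0; apply; apply/rowP => j; rewrite mxE.
have : ip x (g j) = 0 by rewrite x0 ip0l.
rewrite /x linear_sumlz (bigD1 j)//= big1 ?addr0.
  by rewrite ipZl og eqxx mulr1.
by move=> i ij; rewrite ipZl og (negPf ij) mulr0.
Qed.

Lemma basis0_rank (P : bop H) n : orth_proj ip P -> basis P n = 0 -> rank_le P n.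
Proof.
move=> /projlike_of hP b0.
pose g x := \row_(k < n) ip x (basis P k).
have gl l x y : g (l *: x + y) = l *: g x + g y.
  by apply/rowP => j; rewrite !mxE ipDl ipZl.
pose A := GRing.isLinear.Build R[i] H 'rV[R[i]]_n *:%R g gl.
pose G : {linear H -> 'rV[R[i]]_n} := HB.pack g A.
exists G => x Px gx.
have [_ [|[_ r0]]] := pick_unitP (residual_projlike n hP).
  by rewrite -/(basis P n) b0 nrm0 => /esym/eqP; rewrite oner_eq0.
have := residualE P n x; rewrite r0 Px /psum big_nat big1.
  by rewrite subr0.
move=> k /= kn; have /rowP/(_ (Ordinal kn)) := gx.
by rewrite !mxE /= => ->; rewrite scale0r.
Qed.

Lemma basis_eq0_mono f m n : projlike f -> (m <= n)%N -> basis f m = 0 -> basis f n = 0.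
Proof.
move=> hf mn b0.
have [_ [|[_ r0]]] := pick_unitP (residual_projlike m hf).
  by rewrite -/(basis f m) b0 nrm0 => /esym/eqP; rewrite oner_eq0.
have rn x : residual f n x = 0.
  elim: n mn x => [|n IH]; first by rewrite leqn0 => /eqP <-.
  rewrite leq_eqVlt => /orP[/eqP <-//|]; rewrite ltnS => mn x /=.
  by rewrite IH// -/(basis f n) -(residual_basis n hf) IH// scaler0 subrr.
by rewrite -(residual_basis n hf) rn.
Qed.

Lemma basis_unit f n : projlike f -> basis f n <> 0 -> ip (basis f n) (basis f n) = 1.
Proof.
move=> hf bn0; have [_ [h|[]//]] := pick_unitP (residual_projlike n hf).
by rewrite ip_nrm h expr1n.
Qed.

Lemma rank_basis0 (P : bop H) n : orth_proj ip P -> rank_le P n -> basis P n = 0.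
Proof.
move=> hP0 hr; have hP := projlike_of hP0; apply: contrapT => bn0.
have bk0 k : (k < n.+1)%N -> basis P k <> 0.
  by rewrite ltnS => kn bk; apply: bn0; exact: basis_eq0_mono bk.
apply: (@rank_le_orthonormal P n (fun i => basis P i)) hr.
  by move=> i; exact: basis_range.
move=> i j; have [->|ij] := eqVneq i j; first by rewrite basis_unit//; exact: bk0.
by apply: basis_orth => // /ord_inj; apply/eqP.
Qed.

(** Let [m] be the exact rank of [P1].  If [P2] had more than [n - m] basis
    vectors, these and the [m] basis vectors of [P1] would be an orthonormal
    family of [n + 1] vectors in the range of [P]. *)
Lemma rank_le_split (P P1 P2 : bop H) n : orth_proj ip P1 -> orth_proj ip P2 ->
  (forall x, P1 x = x -> P x = x) -> (forall x, P2 x = x -> P x = x) ->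
  (forall x, P1 (P2 x) = 0) ->
  rank_le P n -> exists m k, [/\ (m + k = n)%N, rank_le P1 m & rank_le P2 k].
Proof.
move=> hP1 hP2 P1P P2P P12 hr.
have p1 := projlike_of hP1; have p2 := projlike_of hP2.
have b1n : exists m, basis P1 m == 0.
  by exists n; apply/eqP/rank_basis0 => //; exact: rank_le_mono hr.
have [m /eqP bm hm] := ex_minnP b1n.
have mn : (m <= n)%N.
  by apply: hm; apply/eqP/rank_basis0 => //; exact: rank_le_mono hr.
exists m, (n - m)%N; split; [by rewrite subnKC|exact: basis0_rank|].
apply: basis0_rank => //; apply: contrapT => b2.
have u1 k : (k < m)%N -> ip (basis P1 k) (basis P1 k) = 1.
  move=> km; apply: basis_unit => // bk.
  by have := hm k; rewrite bk eqxx leqNgt km => /(_ isT).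
have u2 k : (k <= n - m)%N -> ip (basis P2 k) (basis P2 k) = 1.
  by move=> kn; apply: basis_unit => // bk; apply: b2; exact: basis_eq0_mono bk.
have cross i j : ip (basis P1 i) (basis P2 j) = 0.
  rewrite -(basis_range i p1) -(basis_range j p2).
  by have [_ _ ->] := p1; rewrite P12 linear0r.
pose g (i : 'I_n.+1) := if (i < m)%N then basis P1 i else basis P2 (i - m).
apply: (@rank_le_orthonormal P n g) hr => [i|i j]; rewrite /g.
  by case: ifP => _; [apply: P1P|apply: P2P]; exact: basis_range.
have [<-|ij] := eqVneq i j.
  case: ltnP => im; first exact: u1.
  by apply: u2; rewrite leq_sub2r// -ltnS.
have ij' : i <> j :> nat by move=> /ord_inj; apply/eqP.
case: ltnP => im; case: ltnP => jm; rewrite ?cross//.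
- exact: basis_orth.
- by rewrite ip_conj cross rmorph0.
- apply: basis_orth => // h; apply: ij'.
  by rewrite -(subnK im) h subnK.
Qed.

Lemma mvn_of_rank (P Q : bop H) : orth_proj ip P -> orth_proj ip Q ->
  (forall n, rank_le P n <-> rank_le Q n) -> mvn_equiv ip P Q.
Proof.
move=> hP hQ h; have p := projlike_of hP; have q := projlike_of hQ.
apply: (@mvn_of_bases (basis P) (basis Q)) => //.
- exact: basis_orth.
- exact: basis_orth.
- move=> k; case: (pselect (basis P k = 0)) => b.
    have b' : basis Q k = 0 by apply: rank_basis0 => //; apply/h; exact: basis0_rank.
    by rewrite b b'.
  rewrite !basis_unit// => b'; apply: b.
  by apply: rank_basis0 => //; apply/h; exact: basis0_rank.
- by move=> x; exact: basis_cvg.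
- by move=> x; exact: basis_cvg.
Qed.

Lemma rank_le0 (P : bop H) : orth_proj ip P -> rank_le P 0 -> forall x, P x = 0.
Proof.
move=> hP [f hf] x; apply: hf; first exact: proj_idem.
by apply/rowP => -[].
Qed.

Lemma null_rank (P : bop H) n : (forall x, P x = 0) -> rank_le P n.
Proof. by move=> h; exists \0 => x <-; rewrite h. Qed.

(** * From the closure of the orbit to equality of ranks *)

Lemma opnorm_le (f : H -> H) r : 0 <= r -> (forall x, nrm (f x) <= r * nrm x) ->
  opnorm f <= r.
Proof.
move=> r0 hf; apply: ge_sup.
  by exists (complex.Re `|f 0|), 0 => //=; rewrite normr0.
move=> _ [x /= x1 <-]; rewrite -/(nrm (f x)) (le_trans (hf x))//.
by rewrite ler_piMr// -lecR -nrmE.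
Qed.

Lemma opnorm_ge (f : bop H) x : nrm (f x) <= opnorm f * nrm x.
Proof.
have [M M0 hM] := bop_bounded f.
have [->|x0] := eqVneq x 0; first by rewrite linear0 nrm0 mulr0.
have n0 : 0 < nrm x.
  by rewrite lt_neqAle nrm_ge0 andbT eq_sym; apply: contraNneq x0 => /nrm_eq0 ->.
rewrite -ler_pdivrMr// mulrC -[X in X * _]ger0_norm ?invr_ge0 ?nrm_ge0//.
rewrite -nrmZr -linearZ; apply: ub_le_sup.
  exists M => _ [y /= y1 <-]; rewrite -/(nrm (f y)) (le_trans (hM y))//.
  by rewrite ler_piMr ?(ltW M0)// -lecR -nrmE.
exists ((nrm x)^-1%:C *: x) => //=.
by rewrite nrmE nrmZr ger0_norm ?invr_ge0 ?nrm_ge0// mulVf ?gt_eqF.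
Qed.

Lemma sub_bop (f g : bop H) : exists k : bop H, forall x, k x = f x - g x.
Proof.
apply: bop_of => [l x y|]; first by rewrite !linearP; vec.
have [M M0 hM] := bop_bounded f; have [N N0 hN] := bop_bounded g.
exists (M + N); first exact: addr_gt0.
by move=> x; rewrite (le_trans (nrmB _ _))// mulrDl lerD.
Qed.

Lemma opnorm_sub (f g : bop H) e x : opnorm (fun x => f x - g x) < e ->
  nrm (f x - g x) <= e * nrm x.
Proof.
have [k kE] := sub_bop f g.
have -> : (fun x => f x - g x) = k by apply/funext => y; rewrite kE.
by move=> h; rewrite -kE (le_trans (opnorm_ge k x))// ler_wpM2r ?nrm_ge0// ltW.
Qed.

Lemma adjoint_rip (v w : bop H) x y : is_adjoint ip v w -> rip (v x) y = rip x (w y).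
Proof. by move=> h; rewrite /rip h. Qed.

(** Each projection absorbs the other because the ranges agree; taking adjoints
    turns [p = q p] into [p = p q = q]. *)
Lemma range_proj_unique (a p q : bop H) : range_proj ip a p -> range_proj ip a q ->
  forall x, p x = q x.
Proof.
have key (p' q' : bop H) : range_proj ip a p' -> range_proj ip a q' ->
    forall x, q' (p' x) = p' x.
  move=> [hp rp] [hq rq] x.
  have : range q' (p' x) by rewrite rq -rp; exists x.
  by move=> [y _ <-]; rewrite proj_idem.
move=> hp hq x; rewrite -(key _ _ hp hq); apply: rip_ext => z.
have [op _] := hp; have [oq _] := hq.
by rewrite proj_rip// proj_rip// (key _ _ hq hp) -proj_rip.
Qed.

Section isometry.
Variables v w p : bop H.
Hypotheses (hp : orth_proj ip p) (vw : is_adjoint ip v w) (wv : w \o v =1 p).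

Lemma isom_nrm x : nrm (v x) = nrm (p x).
Proof.
apply/eqP; rewrite -(@eqrXn2 _ 2)// ?nrm_ge0//; apply/eqP.
by rewrite (proj_sqr x hp) -rip_nrm (adjoint_rip _ _ vw) -[w _]/((w \o v) x) wv ripC.
Qed.

Lemma isom_le x : nrm (v x) <= nrm x.
Proof. by rewrite isom_nrm proj_le. Qed.

Lemma coisom_le y : nrm (w y) <= nrm y.
Proof.
have [->|x0] := eqVneq (nrm (w y)) 0; first exact: nrm_ge0.
have Px0 : 0 < nrm (w y) by rewrite lt_neqAle eq_sym x0 nrm_ge0.
rewrite -(ler_pM2l Px0) -expr2 -rip_nrm -(adjoint_rip _ _ vw).
by rewrite (le_trans (rip_le _ _))// ler_wpM2r ?nrm_ge0// isom_le.
Qed.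

Lemma isom_absorb x : v (p x) = v x.
Proof.
apply/esym/subr0_eq/nrm_eq0; rewrite -linearB isom_nrm linearB/=.
by rewrite proj_idem// subrr nrm0.
Qed.

End isometry.

(** If [w v = 0] then [v = 0], and [Q = v w]. *)
Lemma mvn_zero (P Q : bop H) : mvn_equiv ip P Q ->
  (forall x, P x = 0) -> forall x, Q x = 0.
Proof.
move=> [v [w [vw wv vwQ]]] P0 x; rewrite -vwQ /=.
apply/nrm_eq0/eqP; rewrite -sqrf_eq0 -rip_nrm (adjoint_rip _ _ vw).
by rewrite -[w (v _)]/((w \o v) (w x)) wv P0 rip0r.
Qed.

Lemma mvn_sym (P Q : bop H) : mvn_equiv ip P Q -> mvn_equiv ip Q P.
Proof.
move=> [v [w [vw wv vw']]]; exists w, v; split => // x y.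
by rewrite ip_conj -vw -ip_conj.
Qed.

Lemma comp_lin (f g : bop H) : exists k : {linear H -> H}, forall x, k x = f (g x).
Proof. by exists (bop_fun f \o bop_fun g). Qed.

Section nullsets.
Variables (a : bop H) (E : set (borelC R) -> bop H).
Hypothesis sm : spectral_measure ip a E.

Lemma null_sub D1 D2 : measurable D1 -> measurable D2 -> D1 `<=` D2 ->
  (forall x, E D2 x = 0) -> forall x, E D1 x = 0.
Proof. by move=> m1 m2 h D20 x; rewrite -(setIidl h) (spmI sm)// D20 linear0. Qed.

Lemma spmD D A x : measurable D -> measurable A -> A `<=` D ->
  E D x = E A x + E (D `\` A) x.
Proof.
move=> mD mA AD; rewrite -(spmU sm) ?setDUK//; first exact: measurableD.
by apply/seteqP; split => // z [? []].
Qed.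

Lemma rank_le_subset D1 D2 n : measurable D1 -> measurable D2 -> D1 `<=` D2 ->
  rank_le (E D2) n -> rank_le (E D1) n.
Proof. by move=> m1 m2 h; apply: rank_le_mono => x; exact: (spm_sub sm m1 m2 h). Qed.

(** Lindelof: the squares with rational centre and half-side [1 / (n + 1)] are
    countably many, and those among them that are null cover [D]. *)
Lemma locally_null (D : set (plane R)) : open D ->
  (forall z, D z -> exists2 r, 0 < r & forall x, E (box z r) x = 0) ->
  forall x, E D x = 0.
Proof.
move=> oD hD x.
pose B (q : rat * rat * nat) := box (ratr q.1.1 +i* ratr q.1.2) q.2.+1%:R^-1.
pose F n : set (borelC R) := if unpickle n is Some q then
  if `[< forall x, E (B q) x = 0 >] then B q else set0 else set0.
apply: (@spm_null _ _ sm F) => [|n|z Dz|n].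
- exact: open_borel.
- by rewrite /F; case: unpickle => // q; case: asboolP => // _; exact: box_borel.
- have [r r0 hr] := hD z Dz.
  have [n hn] := invn_lt (divr_gt0 r0 (ltr0Sn _ 1)).
  have n0 : 0 < n.+1%:R^-1 :> R by rewrite invr_gt0.
  have qz (t : R) : exists q : rat, `|t - ratr q| < n.+1%:R^-1.
    move: n0; set c := n.+1%:R^-1 => c0.
    have [|q] := @rat_in_itvoo R (t - c) (t + c).
      by rewrite ltrBlDr -addrA ltrDl addr_gt0.
    rewrite in_itv/= => /andP[h1 h2]; exists q.
    by rewrite ltr_norml; apply/andP; split; lra.
  have [q1 h1] := qz (complex.Re z); have [q2 h2] := qz (complex.Im z).
  have zB : B (q1, q2, n) z by split.
  exists (pickle (q1, q2, n)); [exact: I|rewrite /F pickleK].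
  rewrite asboolT; first exact: zB.
  apply: null_sub hr; [exact: box_borel|exact: box_borel|].
  have tri (s t u c : R) : c < r / 2 -> `|s - t| < c -> `|u - t| < c -> `|u - s| < r.
    by rewrite !ltr_norml => ? /andP[? ?] /andP[? ?]; apply/andP; split; lra.
  by move=> u [h3 h4]; split; [exact: tri h1 h3|exact: tri h2 h4].
- rewrite /F; case: unpickle => [q|]; last exact: spm0 sm _.
  by case: asboolP => // _; exact: spm0 sm _.
Qed.

(** In a punctured square of finite rank, either everything is null or removing a
    small enough concentric square leaves a set of positive rank; in the second
    case the smaller punctured square has smaller rank, and induction applies. *)
Lemma finite_rank_isolated l n r : 0 < r ->
  rank_le (E (box l r `\` [set l])) n ->
  exists s, [/\ 0 < s, s <= r & forall x, E (box l s `\` [set l]) x = 0].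
Proof.
have m1 := borel1 l; have mb s := box_borel l s.
have mD s : measurable (box l s `\` [set l] : set (borelC R)) by exact: measurableD.
elim/ltn_ind: n r => n IH r r0 hr.
pose A j : set (borelC R) := (box l r `\` [set l]) `\` box l j.+1%:R^-1.
have mA j : measurable (A j) by exact: measurableD.
have [[j hj]|/forallNP hA] := pselect (exists j, ~ forall x, E (A j) x = 0).
  pose s := Num.min r j.+1%:R^-1.
  have s0 : 0 < s by rewrite lt_min r0 invr_gt0/=.
  have [|||||m [k [mk h1 h2]]] := @rank_le_split (E (box l r `\` [set l]))
      (E (box l s `\` [set l])) (E (A j)) n _ _ _ _ _ hr.
  - exact: (spm_orth sm (mD s)).
  - exact: (spm_orth sm (mA j)).
  - move=> x; apply: (spm_sub sm) => // z [h1 h2]; split => //.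
    by apply: box_le h1; rewrite ge_min lexx.
  - by move=> x; apply: (spm_sub sm) => // z [].
  - move=> x; apply: (spm_disj sm) => //; apply/seteqP; split => // z [[h1 _] [_ h2]].
    by apply: h2; apply: box_le h1; rewrite ge_min lexx orbT.
  have k0 : (0 < k)%N.
    case: k mk h2 => // _ h0; exfalso; apply: hj.
    exact: (rank_le0 (spm_orth sm (mA j)) h0).
  have [|t [t0 ts ht]] := IH m _ s s0 h1; first by rewrite -mk -addn1 leq_add2l.
  by exists t; split => //; rewrite (le_trans ts)// ge_min lexx.
exists r; split => // x; apply: (@spm_null _ _ sm A) => // [z [zr zl]|j].
  by have [j hj] := box_shrink (introN eqP zl); exists j.
by have /contrapT := hA j; apply.
Qed.

End nullsets.

Lemma open_setD1 (D : set (plane R)) l : open D -> open (D `\` [set l]).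
Proof.
move=> oD; have -> : D `\` [set l] =
    D `&` ((fun z => cabs (z - l)) @^-1` [set` `]0, +oo[]).
  apply/seteqP; split => z [Dz h]; split => //=; rewrite ?in_itv/= ?andbT.
    rewrite lt_neqAle cabs_ge0 andbT eq_sym; apply/eqP => c0; apply: h.
    by apply/subr0_eq/eqP; rewrite -normr_eq0 cabsE c0.
  by move=> zl; move: h; rewrite /= in_itv/= andbT zl subrr (cabs_real 0) normr0 ltxx.
apply: openI => //; apply: open_preim; last exact: interval_open.
move=> u v; rewrite (le_trans (lip1_cabs _ _))//.
by rewrite opprB addrA subrK.
Qed.

(** Strong induction on [n].  If every point of [D] has an [F]-null square
    around it, then [E] is locally null on [D].  Otherwise pick a point [l] of [D]
    that has none.
    By [finite_rank_isolated] a square around [l] has the same [F]-rank [k] as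
    the point itself, and [k > 0]; the hypothesis on squares bounds the [E]-rank
    of [l] by [k], and the induction hypothesis applies to [D] minus [l]. *)
Lemma rank_le_open (a b : bop H) E F : spectral_measure ip a E ->
  spectral_measure ip b F ->
  (forall l r, 0 < r -> ~ box l r 0 -> exists2 s, 0 < s &
     forall m, rank_le (F (box l r)) m -> rank_le (E (box l s)) m) ->
  forall n (D : set (plane R)), open D -> D `<=` ~` [set 0] ->
    rank_le (F D) n -> rank_le (E D) n.
Proof.
move=> smE smF hbox n; elim/ltn_ind: n => n IH D oD D0 hF.
have mD := open_borel oD.
have [[l hl0]|/forallNP hD] := pselect (exists l, ~ (D l ->
    exists2 r, 0 < r & forall x, F (box l r) x = 0)); last first.
  apply: null_rank; apply: (locally_null smE oD) => z Dz.
  have /contrapT/(_ Dz)[r r0 hr] := hD z.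
  have [s s0 hs] := open_box oD Dz.
  pose t := Num.min r s.
  have t0 : 0 < t by rewrite lt_min r0.
  have [|u u0 hu] := hbox z t t0.
    move=> h; apply: (D0 0) => //; apply: hs; apply: box_le h.
    by rewrite ge_min lexx orbT.
  exists u => //; apply: rank_le0; first exact: (spm_orth smE (box_borel _ _)).
  apply: hu; apply: null_rank; apply: (null_sub smF _ _ _ hr); try exact: box_borel.
  by apply: box_le; rewrite ge_min lexx.
have Dl : D l by apply: contrapT => nD; apply: hl0 => /nD.
have hl h : False := hl0 (fun=> h).
have m1 := borel1 l.
have [r r0 rD] := open_box oD Dl.
have mb s : measurable (box l s `\` [set l] : set (borelC R)).
  by apply: measurableD => //; exact: box_borel.
have hr : rank_le (F (box l r `\` [set l])) n.
  by apply: (rank_le_subset smF _ _ _ hF) => // z [/rD].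
have [s [s0 sr hs]] := finite_rank_isolated smF r0 hr.
have FE x : F (box l s) x = F [set l] x.
  rewrite (@spmD _ _ smF _ [set l]) ?hs ?addr0//; first exact: box_borel.
  by move=> _ ->; exact: box_center.
have mDl : measurable (D `\` [set l] : set (borelC R)) by exact: measurableD.
have [|||||m [k [mk h1 h2]]] := @rank_le_split (F D)
    (F (D `\` [set l])) (F [set l]) n _ _ _ _ _ hF.
- exact: (spm_orth smF mDl).
- exact: (spm_orth smF m1).
- by move=> x; apply: (spm_sub smF) => // z [].
- by move=> x; apply: (spm_sub smF) => // z ->.
- by move=> x; apply: (spm_disj smF) => //; apply/seteqP; split => // z [[]].
have k0 : (0 < k)%N.
  case: k mk h2 => // _ /(rank_le0 (spm_orth smF m1)) F0.
  by exfalso; apply: hl; exists s => // x; rewrite FE F0.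
rewrite -mk; apply: (@rank_le_add _ (E (D `\` [set l])) (E [set l])).
- by move=> x; exact: (spm_idem smE x mDl).
- by move=> x; exact: (spm_idem smE x m1).
- by move=> x; rewrite addrC; apply: (spmD smE) => // _ ->.
- apply: IH => //; first by rewrite -mk -addn1 leq_add2l.
    exact: open_setD1.
  by move=> z [/D0].
have [|t t0 ht] := hbox l s s0.
  by move=> h; apply: (D0 0) => //; apply: rD; apply: box_le h.
apply: (@rank_le_subset _ _ smE _ (box l t)) => //; first exact: box_borel.
  by move=> _ ->; exact: box_center.
by apply: ht; apply: rank_le_mono h2 => x; rewrite FE.
Qed.

Lemma cabs_box l r : ~ box l r 0 -> r <= cabs l.
Proof.
move=> h; rewrite leNgt; apply/negP => lr; apply: h.
by split; rewrite sub0r normrN; apply: le_lt_trans lr; [exact: cabs_Re|exact: cabs_Im].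
Qed.

Section closure_to_ranks.
Variables (a b : bop H) (E F : set (borelC R) -> bop H).
Hypotheses (smE : spectral_measure ip a E) (smF : spectral_measure ip b F).
Hypothesis b_closure : opclosure (groupoid_orbit ip a) b.

Lemma orbit_approx e : 0 < e -> exists v w : bop H,
  [/\ is_adjoint ip v w, w \o v =1 E (~` [set 0]) &
      forall x, nrm (b x - v (a (w x))) <= e * nrm x].
Proof.
move=> e0; have [c [v [w [p [hp vw wv cE]]]] bc] := b_closure e0.
exists v, w; split => // x.
  by rewrite wv (range_proj_unique hp (spm_range_proj smE)).
by have := opnorm_sub x bc; rewrite cE.
Qed.

(** With [s = r / 16] and an approximation of [b] up to [r / 8], both defects add
    up to [r / 4].  First half: on [v x] the operator [b - l] is at most
    [r / 4] times the norm, while it would be at least [r] times the norm if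
    [F Q] killed [v x].  Second half: in the same way [|w y| <= |y| / 4] if [E Q]
    kills [w y], but [|a w y| = |v a w y|] is close to [|l| |y|], so [w y] cannot
    be that small; here [r <= |l|] is used, that is, the square avoids [0]. *)
Lemma box_rank l r : 0 < r -> ~ box l r 0 -> exists2 s, 0 < s & forall m,
  (rank_le (F (box l r)) m -> rank_le (E (box l s)) m) /\
  (rank_le (E (box l r)) m -> rank_le (F (box l s)) m).
Proof.
move=> r0 hl; pose s := r / 16.
have s0 : 0 < s by rewrite divr_gt0.
have sr : s <= r by rewrite /s; lra.
have r80 : 0 < r / 8 by rewrite divr_gt0.
have [v [w [vw wv bv]]] := orbit_approx r80.
have m0 := borel1 (0 : R[i]); have mC := measurableC m0.
have hp := spm_orth smE mC; set p := E (~` [set 0]) in wv hp.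
have mb t := box_borel l t.
have pE x : E (box l s) x = x -> p x = x.
  apply: (spm_sub smE) => // z zs /= z0; apply: hl; rewrite -z0.
  exact: box_le zs.
have pa x : p (a x) = a x by exact: spm_range smE x.
have lr := cabs_box hl.
exists s => // m; split.
  have [J JE] := comp_lin (F (box l r)) v.
  apply: (@rank_le_pullback _ _ J) => x Ex; rewrite JE ?(spm_idem smF)// => Fv.
  have nv : nrm (v x) = nrm x by rewrite (isom_nrm hp vw wv) pE.
  have h1 := spm_upper_box smE s0 Ex.
  have h2 : nrm (b (v x) - l *: v x) <= r / 8 * nrm x + 2 * s * nrm x.
    rewrite (le_trans (nrm_triB _ (v (a (w (v x)))) _))// lerD//.
      by rewrite -nv bv.
    rewrite -[w (v x)]/((w \o v) x) wv pE//.
    by rewrite -linearZ -linearB (le_trans (isom_le hp vw wv _)).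
  have := @spm_lower _ _ smF l r (~` box l r) (v x) r0 (measurableC (mb r)).
  rewrite (spm_setC smF)// Fv subr0 nv => /(_ (fun _ h => h) erefl) h3.
  apply: nrm_eq0; have := nrm_ge0 x; move: h2 h3; rewrite /s => h2 h3 h4.
  have h5 : r * nrm x <= r / 4 * nrm x.
    apply: (le_trans h3); apply: (le_trans h2); rewrite -mulrDl.
    by apply: ler_wpM2r => //; lra.
  by apply/eqP; rewrite eq_le h4 andbT -(pmulr_rle0 _ r0); nra.
have [J JE] := comp_lin (E (box l r)) w.
apply: (@rank_le_pullback _ _ J) => y Fy; rewrite JE ?(spm_idem smE)// => Ew.
pose x := w y.
have h1 := spm_upper_box smF s0 Fy.
have h2 : nrm (v (a x) - l *: y) <= r / 4 * nrm y.
  rewrite (le_trans (nrm_triB _ (b y) _))// nrmBC.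
  have := lerD (bv y) h1; move/le_trans; apply.
  by rewrite -mulrDl ler_wpM2r ?nrm_ge0// /s; lra.
have e1 : a x - l *: x = w (v (a x) - l *: y).
  by rewrite (linearB w) (linearZ_LR w)/= -[w (v _)]/((w \o v) (a x)) wv pa.
have h3 : nrm (a x - l *: x) <= r / 4 * nrm y.
  by rewrite e1 (le_trans (coisom_le hp vw wv _)).
have := @spm_lower _ _ smE l r (~` box l r) x r0 (measurableC (mb r)).
rewrite (spm_setC smE)// Ew subr0 => /(_ (fun _ h => h) erefl) h4.
have h5 : nrm (v (a x)) = nrm (a x) by rewrite (isom_nrm hp vw wv) pa.
have := nrm_triB (l *: y) (v (a x)) 0; rewrite !subr0 nrmZ nrmBC h5 => h6.
have := nrm_triB (a x) (l *: x) 0; rewrite !subr0 nrmZ => h7.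
have h8 : r * nrm x <= r / 4 * nrm y := le_trans h4 h3.
have h9 : nrm x <= nrm y / 4.
  by rewrite -(ler_pM2l r0) (le_trans h8)//; lra.
apply: nrm_eq0; apply/eqP; rewrite eq_le nrm_ge0 andbT.
have l0 : 0 < cabs l by rewrite (lt_le_trans r0).
rewrite -(pmulr_rle0 _ l0).
have h10 := ler_wpM2l (ltW l0) h9.
have h11 := ler_wpM2r (nrm_ge0 y) lr.
lra.
Qed.

Lemma closure_mvn (D : set (plane R)) : open D -> D `<=` ~` [set 0] ->
  mvn_equiv ip (E D) (F D).
Proof.
move=> oD D0; have mD := open_borel oD.
apply: mvn_of_rank => [||n]; first exact: (spm_orth smE mD).
  exact: (spm_orth smF mD).
split.
  apply: (rank_le_open smF smE _ oD D0) => l r r0 /(box_rank r0)[s s0 hs].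
  by exists s => // m /(hs m).2.
apply: (rank_le_open smE smF _ oD D0) => l r r0 /(box_rank r0)[s s0 hs].
by exists s => // m /(hs m).1.
Qed.

End closure_to_ranks.

(** A nonzero point is in the spectrum iff small squares around it, which avoid
    [0], carry nonzero projections, and equivalence preserves that. *)
Lemma mvn_spectrum (a b : bop H) E F : spectral_measure ip a E ->
  spectral_measure ip b F ->
  (forall D : set (plane R), open D -> D `<=` ~` [set 0] -> mvn_equiv ip (E D) (F D)) ->
  spectrum a `<=` spectrum b `|` [set 0].
Proof.
move=> smE smF hEF l hl; have [->|l0] := eqVneq l 0; first by right.
left; apply/(spectrumP smF) => r r0; apply: contrapT => /forallNP h.
have [n hn] := box_shrink (l := l) (z := 0) (ltac:(by rewrite eq_sym)).
pose s := Num.min r n.+1%:R^-1.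
have s0 : 0 < s by rewrite lt_min r0 invr_gt0/=.
have F0 : forall x, F (box l s) x = 0.
  apply: (null_sub smF) (fun x => contrapT (h x)); try exact: box_borel.
  by apply: box_le; rewrite ge_min lexx.
have [x] := (spectrumP smE l).1 hl s s0; apply.
apply: mvn_zero F0 x; apply: mvn_sym; apply: hEF; first exact: box_open.
move=> z zs /= z0; apply: hn; rewrite -z0; apply: box_le zs.
by rewrite ge_min lexx orbT.
Qed.

(** * From equality of ranks to the closure of the orbit *)

Lemma comp_bop (f g : bop H) : exists k : bop H, forall x, k x = f (g x).
Proof.
apply: bop_of => [l x y|]; first by rewrite !linearP.
have [M M0 hM] := bop_bounded f; have [N N0 hN] := bop_bounded g.
exists (M * N); first exact: mulr_gt0.
by move=> x; rewrite (le_trans (hM _))// -mulrA ler_wpM2l// ltW.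
Qed.

Lemma sum_bop (I : finType) (f : I -> bop H) :
  exists k : bop H, forall x, k x = \sum_i f i x.
Proof.
apply: bop_of => [l x y|].
  rewrite scaler_sumr -big_split/=; apply: eq_bigr => i _.
  by rewrite linearP.
have /choice[M hM] : forall i, exists M, 0 < M /\ forall x, nrm (f i x) <= M * nrm x.
  by move=> i; have [M M0 hM] := bop_bounded (f i); exists M.
exists (1 + \sum_i M i).
  by rewrite ltr_pwDl// sumr_ge0// => i _; rewrite ltW//; case: (hM i).
move=> x; rewrite mulrDl mul1r mulr_suml.
apply: (@le_trans _ _ (\sum_i M i * nrm x)); last by rewrite lerDr nrm_ge0.
elim/big_ind2: _ => [|u s v t h1 h2|i _]; first by rewrite nrm0.
  by rewrite (le_trans (nrmD _ _))// lerD.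
by case: (hM i).
Qed.

Lemma nrm_sum_orth (I : finType) (u : I -> H) :
  (forall i j, i != j -> ip (u i) (u j) = 0) ->
  nrm (\sum_i u i) ^+ 2 = \sum_i nrm (u i) ^+ 2.
Proof.
move=> ou; apply: (@complexI R); rewrite rmorph_sum/= -ip_nrm linear_sumlz.
apply: eq_bigr => i _; rewrite -ip_nrm /= linear_sumr (bigD1 i)//= big1 ?addr0//.
by move=> j ji; rewrite ou// eq_sym.
Qed.

Section blocks.
Variables (a b : bop H) (E F : set (borelC R) -> bop H).
Hypotheses (smE : spectral_measure ip a E) (smF : spectral_measure ip b F).
Variables (I : finType) (Q : I -> set (borelC R)) (l : I -> R[i]) (r : R).
Hypotheses (r0 : 0 < r) (mQ : forall i, measurable (Q i)).
Hypothesis disQ : forall i j, i != j -> Q i `&` Q j = set0.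
Hypothesis coverE : forall x, E (~` [set 0]) x = \sum_i E (Q i) x.
Hypothesis coverF : forall x, F (~` [set 0]) x = \sum_i F (Q i) x.
Hypothesis smallQ : forall i z, Q i z ->
  `|complex.Re z - complex.Re (l i)| <= r /\ `|complex.Im z - complex.Im (l i)| <= r.
Hypothesis mvnQ : forall i, mvn_equiv ip (E (Q i)) (F (Q i)).

(** The error [b y - v a v^* y] is the orthogonal sum over the cells of
    [(b - l_i) F Q_i y - v_i (a - l_i) v_i^* y], and each of the two terms has
    norm at most [2 r |F Q_i y|]. *)
Lemma block_approx : exists2 c, groupoid_orbit ip a c &
  opnorm (fun x => b x - c x) <= 4 * r.
Proof.
have m0 := borel1 (0 : R[i]); have mC := measurableC m0.
have /choice[v hv] := mvnQ; have /choice[w hvw] := hv.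
have vw i : is_adjoint ip (v i) (w i) by case: (hvw i).
have wv i : w i \o v i =1 E (Q i) by case: (hvw i).
have vw' i : v i \o w i =1 F (Q i) by case: (hvw i).
have wv_adj i : is_adjoint ip (w i) (v i).
  by move=> x y; rewrite ip_conj -vw -ip_conj.
have oE i := spm_orth smE (mQ i); have oF i := spm_orth smF (mQ i).
have vE i x : v i (E (Q i) x) = v i x := isom_absorb (oE i) (vw i) (wv i) x.
have wF i x : w i (F (Q i) x) = w i x := isom_absorb (oF i) (wv_adj i) (vw' i) x.
have Fv i x : F (Q i) (v i x) = v i x.
  by rewrite -vw' /= -[w i (v i x)]/((w i \o v i) x) wv vE.
have Ew i x : E (Q i) (w i x) = w i x.
  by rewrite -wv /= -[v i (w i x)]/((v i \o w i) x) vw' wF.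
have wv0 i j x : i != j -> w i (v j x) = 0.
  by move=> ij; rewrite -wF -Fv (spm_disj smF) ?linear0//; exact: disQ.
have vaw0 i j x : i != j -> v i (a (w j x)) = 0.
  move=> ij; rewrite -vE -(Ew j) -(spm_commute smE)//.
  by rewrite (spm_disj smE) ?linear0//; exact: disQ.
have [V VE] := sum_bop v; have [W WE] := sum_bop w.
have [aW aWE] := comp_bop a W; have [c cE] := comp_bop V aW.
have cE' x : c x = \sum_i v i (a (w i x)).
  rewrite cE aWE VE WE; apply: eq_bigr => i _.
  rewrite !linear_sum (bigD1 i)//= big1 ?addr0// => j ji.
  by rewrite vaw0// eq_sym.
exists c.
  exists V, W, (E (~` [set 0])); split.
  - exact: (spm_range_proj smE).
  - move=> x y; rewrite VE WE linear_sumlz linear_sumr/=.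
    by apply: eq_bigr => i _; exact: vw.
  - move=> x /=; rewrite VE WE coverE; apply: eq_bigr => i _.
    rewrite linear_sum (bigD1 i)//= big1 ?addr0 => [|j ji].
      by rewrite -wv.
    by rewrite wv0// eq_sym.
  - by move=> x; rewrite cE aWE.
apply: opnorm_le => [|y]; first by rewrite mulr_ge0// ltW.
pose u i := b (F (Q i) y) - v i (a (w i y)).
have uE : b y - c y = \sum_i u i.
  rewrite /u sumrB cE'; congr (_ - _).
  by rewrite -linear_sum -coverF -(spm_commute smF)// (spm_range smF).
have Fu i : F (Q i) (u i) = u i.
  by rewrite linearB/= Fv (spm_commute smF)// (spm_idem smF).
have uu i j : i != j -> ip (u i) (u j) = 0.
  move=> ij; rewrite -(Fu i) -(Fu j); have [_ ->] := oF i.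
  by rewrite (spm_disj smF) ?linear0r//; exact: disQ.
have nu i : nrm (u i) <= 4 * r * nrm (F (Q i) y).
  have -> : u i = (b (F (Q i) y) - l i *: F (Q i) y) - v i (a (w i y) - l i *: w i y).
    rewrite (linearB (v i)) (linearZ_LR (v i))/= -[v i (w i y)]/((v i \o w i) y) vw'.
    by rewrite /u; vec.
  rewrite (le_trans (nrmB _ _))//.
  have nw : nrm (w i y) = nrm (F (Q i) y) := isom_nrm (oF i) (wv_adj i) (vw' i) y.
  have h1 := spm_upper smF r0 (mQ i) (@smallQ i) (spm_idem smF y (mQ i)).
  have h2 := spm_upper smE r0 (mQ i) (@smallQ i) (Ew i y).
  have h3 := isom_le (oE i) (vw i) (wv i) (a (w i y) - l i *: w i y).
  by rewrite nw in h2; lra.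
rewrite uE -(@ler_pXn2r _ 2)// ?nnegrE ?mulr_ge0 ?nrm_ge0 ?(ltW r0)//.
rewrite nrm_sum_orth//.
apply: (@le_trans _ _ (\sum_i (4 * r) ^+ 2 * nrm (F (Q i) y) ^+ 2)).
  apply: ler_sum => i _; rewrite -exprMn.
  by rewrite ler_pXn2r// ?nnegrE ?mulr_ge0 ?nrm_ge0 ?(ltW r0).
rewrite -mulr_sumr [leRHS]exprMn ler_wpM2l ?sqr_ge0//.
rewrite -nrm_sum_orth => [|i j ij].
  by rewrite -coverF ler_pXn2r ?nnegrE ?nrm_ge0// proj_le//; exact: (spm_orth smF mC).
by have [_ ->] := oF i; rewrite (spm_disj smF) ?linear0r//; exact: disQ.
Qed.

End blocks.

Section levels.
Variables (a : bop H) (E : set (borelC R) -> bop H).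
Hypothesis sm : spectral_measure ip a E.
Variable f : R[i] -> R.
Hypothesis lf : lip1 f.

Definition level t : set (borelC R) := f @^-1` [set t].
Definition atom t := ~ forall x, E (level t) x = 0.

Lemma level_borel t : measurable (level t).
Proof. exact: borel_preim. Qed.

(** Unit vectors taken in the ranges of [E] on distinct levels are at distance
    [sqrt 2], so the points of a dense sequence within [1 / 2] of them are
    distinct. *)
Lemma countable_atoms : countable atom.
Proof.
have hu t : exists x, atom t -> E (level t) x = x /\ nrm x = 1.
  have [ht|nt] := pselect (atom t); last by exists 0.
  have /existsNP[y hy] := ht.
  have y0 : nrm (E (level t) y) != 0 by apply/eqP => /nrm_eq0.
  exists ((nrm (E (level t) y))^-1%:C *: E (level t) y) => _; split.
    by rewrite linearZ/= (spm_idem sm)//; exact: level_borel.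
  by rewrite nrmZr ger0_norm ?invr_ge0 ?nrm_ge0// mulVf.
have [u hu'] := choice hu.
have hn t : exists n, nrm (u t - d n) < 1 / 2 by apply: dense_d; lra.
have [g hg] := choice hn.
apply/countable_injP; exists g => s t /set_mem/hu'[us ns] /set_mem/hu'[ut nt] st.
apply: contrapT => ne.
have o : rip (u s) (u t) = 0.
  rewrite -us -ut proj_rip; last exact: (spm_orth sm (level_borel s)).
  rewrite (spm_disj sm) ?rip0r//; [exact: level_borel|exact: level_borel|].
  apply/seteqP; split => // z []; rewrite /level/= => fs ft.
  by apply: ne; rewrite -fs -ft.
have := nrm_sub_sqr (u s) (u t); rewrite ns nt o.
have := nrm_triB (u s) (d (g s)) (u t); have := hg s; have := hg t.
rewrite -st (nrmBC (d (g s)) (u t)) => h1 h2 h3 h4.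
have h5 := nrm_ge0 (u s - u t).
have : nrm (u s - u t) < 1 by lra.
nra.
Qed.

Variables (g : nat -> R) (n : nat) (M : R).
Hypothesis supp : forall x, E [set z | cabs z <= M] x = x.
Hypothesis gmono : forall i, g i < g i.+1.
Hypothesis gatom : forall i x, E (level (g i)) x = 0.
Hypothesis g0M : g 0%N <= - M.
Hypothesis gnM : M < g n.
Hypothesis fb : forall z, `|f z| <= cabs z.

Definition strip i : set (borelC R) := f @^-1` [set` `]g i, g i.+1[].

Lemma strip_borel i : measurable (strip i).
Proof. exact: borel_preim. Qed.

Lemma strip_open i : open (strip i : set (plane R)).
Proof. by apply: open_preim => //; exact: interval_open. Qed.

(** The half-open strip between [g 0] and [g m] grows by a null level and an open
    strip when [m] increases, and for [m = n] it contains the support of [E]. *)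
Lemma strip_sum x : \sum_(i < n) E (strip i) x = x.
Proof.
pose V m : set (borelC R) := f @^-1` [set` `[g 0%N, g m[].
have mV m : measurable (V m) by exact: borel_preim.
have gle m : g 0%N <= g m.
  by elim: m => // m IH; rewrite (le_trans IH)// ltW.
have step m : E (V m) x = \sum_(i < m) E (strip i) x.
  elim: m => [|m IH].
    rewrite big_ord0; have -> : V 0%N = set0; last exact: spm0 sm x.
    by apply/seteqP; split => // z; rewrite /V/= in_itv/= => /andP[h]; rewrite ltNge h.
  rewrite big_ord_recr/= -IH.
  have -> : V m.+1 = V m `|` (level (g m) `|` strip m).
    apply/seteqP; split => z; rewrite /V/level/strip/= !in_itv/=.
      move=> /andP[h1 h2]; have [h|h|h] := ltgtP (f z) (g m).
      - by left; rewrite h1.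
      - by right; right; rewrite h2.
      - by right; left.
    move=> [/andP[h1 h2]|[->|/andP[h1 h2]]].
    - by rewrite h1 (lt_trans h2).
    - by rewrite gle gmono.
    - by rewrite h2 andbT (le_trans (gle m))// ltW.
  have ml := level_borel (g m); have ms := strip_borel m.
  rewrite (spmU sm)//; [|exact: measurableU|]; last first.
    apply/seteqP; split => // z; rewrite /V/level/strip/= !in_itv/=.
    move=> [/andP[_ h1] [h|/andP[h _]]]; first by rewrite h ltxx in h1.
    by rewrite ltNge (ltW h) in h1.
  rewrite (spmU sm)//; last first.
    apply/seteqP; split => // z; rewrite /level/strip/= !in_itv/=.
    by move=> [-> /andP[]]; rewrite ltxx.
  by rewrite gatom add0r.
rewrite -step; apply: (spm_sub sm _ _ _ (supp x)) => //; first exact: disc_borel.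
move=> z /= zM; rewrite /V/= in_itv/=.
have := le_trans (fb z) zM; rewrite ler_norml => /andP[h1 h2].
by rewrite (le_trans g0M)//= (le_lt_trans h2).
Qed.

Lemma strip_disj i j : i != j -> strip i `&` strip j = set0.
Proof.
have gm m k : (m <= k)%N -> g m <= g k.
  elim: k => [|k IH]; first by rewrite leqn0 => /eqP ->.
  by rewrite leq_eqVlt => /orP[/eqP ->//|/IH h]; rewrite (le_trans h)// ltW.
have key m k : (m < k)%N -> strip m `&` strip k = set0.
  move=> mk; apply/seteqP; split => // z; rewrite /strip/= !in_itv/=.
  move=> [/andP[_ h1] /andP[h2 _]].
  by have := gm _ _ mk; rewrite leNgt (lt_trans h2 h1).
rewrite neq_ltn => /orP[|ji]; first exact: key.
by rewrite setIC key.
Qed.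

End levels.

Lemma countable_setU (T : Type) (A B : set T) :
  countable A -> countable B -> countable (A `|` B).
Proof.
move=> cA cB; rewrite -bigcup2E; apply: bigcup_countable => [|i _].
  exact: countableP.
by case: i => [|[|i]] //=; exact: countable0.
Qed.

(** An interval contained in [B] would have Lebesgue measure 0. *)
Lemma avoid_countable (B : set R) s t : countable B -> s < t ->
  exists u : R, [/\ s < u, u < t & ~ B u].
Proof.
move=> cB st; apply: contrapT => /forallNP h.
have hB : [set` `]s, t[] `<=` B.
  by move=> x; rewrite /= in_itv/= => /andP[h1 h2]; apply: contrapT => nB; apply: (h x).
have /countable_lebesgue_measure0 := sub_countable (subset_card_le hB) cB.
rewrite lebesgue_measure_itv/= lte_fin st -EFinB => -[] /eqP.
by rewrite subr_eq0 gt_eqF.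
Qed.

(** The grid lines [g i] are chosen one by one, each in its own interval of
    length [h], so that consecutive lines are at distance at most [2 h].  The
    interval of [g i] starts below [- M] and moves by [h], hence [g] is increasing
    and crosses [[- M, M]].  The error of [block_approx] is then [8 h = e / 2]. *)
Lemma ranks_closure (a b : bop H) E F : spectral_measure ip a E ->
  spectral_measure ip b F ->
  (forall D : set (plane R), open D -> D `<=` ~` [set 0] -> mvn_equiv ip (E D) (F D)) ->
  opclosure (groupoid_orbit ip a) b.
Proof.
move=> smE smF hEF e e0.
have [M1 M10 hM1] := spm_bounded_support smE.
have [M2 M20 hM2] := spm_bounded_support smF.
pose M := Num.max M1 M2.
have suppE x : E [set z | cabs z <= M] x = x.
  apply: (spm_sub smE (disc_borel _) (disc_borel _) _ (hM1 x)) => z /= /le_trans.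
  by apply; rewrite le_max lexx.
have suppF x : F [set z | cabs z <= M] x = x.
  apply: (spm_sub smF (disc_borel _) (disc_borel _) _ (hM2 x)) => z /= /le_trans.
  by apply; rewrite le_max lexx orbT.
pose h := e / 16; have h0 : 0 < h by rewrite divr_gt0.
pose B := (atom E (@complex.Re R) `|` atom E (@complex.Im R)) `|`
          (atom F (@complex.Re R) `|` atom F (@complex.Im R)).
have cB : countable B.
  by do !apply: countable_setU;
    [apply: (countable_atoms smE); exact: lip1_Re
    |apply: (countable_atoms smE); exact: lip1_Im
    |apply: (countable_atoms smF); exact: lip1_Re
    |apply: (countable_atoms smF); exact: lip1_Im].
have hg (i : nat) : exists x : R, [/\ - M - h + i%:R * h < x, x < - M + i%:R * h & ~ B x].
  by apply: avoid_countable => //; lra.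
have [g hg'] := choice hg.
have glo i : - M - h + i%:R * h < g i by case: (hg' i).
have ghi i : g i < - M + i%:R * h by case: (hg' i).
have gB i : ~ B (g i) by case: (hg' i).
have gmono i : g i < g i.+1.
  by rewrite (lt_trans (ghi i))// (le_lt_trans _ (glo _))// -natr1; lra.
have gwidth i : g i.+1 - g i <= 2 * h.
  by have := ghi i.+1; have := glo i; rewrite -natr1; lra.
have g0M : g 0%N <= - M by have := ghi 0%N; rewrite mul0r addr0 => /ltW.
have [n gnM] : exists n, M < g n.
  have K0 : 0 < 2 * M + h by rewrite addr_gt0// mulr_gt0// lt_max M10.
  have [n hn] := invn_lt (divr_gt0 h0 K0).
  exists n.+1; rewrite (le_lt_trans _ (glo n.+1))//.
  by move: hn; rewrite ltr_pdivlMr// mulrC ltr_pdivrMr//; lra.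
have gER i x : E (level (@complex.Re R) (g i)) x = 0.
  by move: x; apply: contrapT => hx; apply: (gB i); left; left.
have gEI i x : E (level (@complex.Im R) (g i)) x = 0.
  by move: x; apply: contrapT => hx; apply: (gB i); left; right.
have gFR i x : F (level (@complex.Re R) (g i)) x = 0.
  by move: x; apply: contrapT => hx; apply: (gB i); right; left.
have gFI i x : F (level (@complex.Im R) (g i)) x = 0.
  by move: x; apply: contrapT => hx; apply: (gB i); right; right.
pose SR i := strip (@complex.Re R) g i; pose SI i := strip (@complex.Im R) g i.
have mSR i : measurable (SR i) by apply: strip_borel; exact: lip1_Re.
have mSI i : measurable (SI i) by apply: strip_borel; exact: lip1_Im.
pose Q (i : 'I_n * 'I_n) : set (borelC R) := (SR i.1 `&` SI i.2) `\` [set 0].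
have m0 := borel1 (0 : R[i]); have mC := measurableC m0.
have mS i j : measurable (SR i `&` SI j) by exact: measurableI.
have mQ i : measurable (Q i) by exact: measurableD.
have r0 : 0 < 2 * h by rewrite mulr_gt0.
have cover (c : bop H) G (smG : spectral_measure ip c G) :
    (forall x, \sum_(i < n) G (SR i) x = x) ->
    (forall x, \sum_(i < n) G (SI i) x = x) ->
    forall x, G (~` [set 0]) x = \sum_i G (Q i) x.
  move=> hR hI x; rewrite -{1}(hR (G _ x)).
  rewrite -(pair_big xpredT xpredT (fun i j => G (Q (i, j)) x))/=.
  apply: eq_bigr => i _; rewrite -{1}(hI (G _ x)) linear_sum.
  apply: eq_bigr => j _.
  by rewrite /Q setDE (spmI smG)// (spmI smG).
have [|||||c oc hc] := @block_approx a b E F smE smF _ Q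
  (fun i => g i.1 +i* g i.2) (2 * h) r0 mQ _ _ _ _ _.
- move=> [i1 i2] [j1 j2]; rewrite xpair_eqE negb_and => /orP[ij|ij];
    apply/seteqP; split => // z [[[z1 z2] _] [[z3 z4] _]].
    by have := strip_disj (@complex.Re R) gmono ij; rewrite -subset0 => /(_ z); apply.
  by have := strip_disj (@complex.Im R) gmono ij; rewrite -subset0 => /(_ z); apply.
- apply: (cover _ _ smE) => x.
    exact: (strip_sum smE lip1_Re suppE gmono gER g0M gnM cabs_Re).
  exact: (strip_sum smE lip1_Im suppE gmono gEI g0M gnM cabs_Im).
- apply: (cover _ _ smF) => x.
    exact: (strip_sum smF lip1_Re suppF gmono gFR g0M gnM cabs_Re).
  exact: (strip_sum smF lip1_Im suppF gmono gFI g0M gnM cabs_Im).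
- move=> [i j] z [[]]; rewrite /SR/SI/strip/= !in_itv/= => /andP[h1 h2] /andP[h3 h4] _.
  have := gwidth i; have := gwidth j => h5 h6.
  by split; rewrite ger0_norm; lra.
- move=> i; apply: hEF; last by move=> z [].
  by apply: open_setD1; apply: openI; apply: strip_open; [exact: lip1_Re|exact: lip1_Im].
by exists c => //; rewrite (le_lt_trans hc)// /h; lra.
Qed.

End HilbertSpace.

Theorem proposition5p4 (R : realType) (H : completeNormedModType R[i])
    (ip : {dot H for (@Num.conj R[i])})
    (ip_norm : forall x : H, ip x x = `|x| ^+ 2)
    (H_separable : separable H) (H_infinite : infinite_dim H)
    (a b : bop H) (a_normal : normal_op ip a) (b_normal : normal_op ip b)
    (Ea Eb : set (borelC R) -> bop H)
    (Ea_spectral : spectral_measure ip a Ea)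
    (Eb_spectral : spectral_measure ip b Eb) :
  opclosure (groupoid_orbit ip a) b <->
  (spectrum a `|` [set 0] = spectrum b `|` [set 0] /\
   forall D : set (plane R), open D -> D `<=` ~` [set 0] ->
     mvn_equiv ip (Ea D) (Eb D)).
Proof.
have [d hd] := dense_seq H_separable.
split=> [hb|[_ hmvn]]; last first.
  exact: (ranks_closure ip_norm hd Ea_spectral Eb_spectral hmvn).
have hmvn := closure_mvn ip_norm hd Ea_spectral Eb_spectral hb.
split=> //; apply/seteqP; split => l [|]; [|by right| |by right].
  exact: (mvn_spectrum ip_norm Ea_spectral Eb_spectral hmvn).
apply: (mvn_spectrum ip_norm Eb_spectral Ea_spectral) => D oD D0.
exact/mvn_sym/hmvn.
Qed.
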